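(* Let $\mathfrak{L}$ be a left Leibniz algebra over a field $\mathbb{F}$ of characteristic zero. Then the following statements are equivalent: (i) $\mathfrak{L}$ is finite-dimensional Lie-simple. (ii) There exists a finite-dimensional simple Lie subalgebra $\mathfrak{g}$ of $\mathfrak{L}$ such that $\mathfrak{L}=\mathfrak{g}\oplus\mathrm{Leib}(\mathfrak{L})$ (as vector spaces), and $\mathrm{Leib}(\mathfrak{L})$ is a finite-dimensional completely reducible anti-symmetric $\mathfrak{g}$-bimodule that does not contain any non-zero trivial $\mathfrak{g}$-subbimodule. (iii) $\mathfrak{L}$ is isomorphic to the left hemi-semidirect product $\mathfrak{g}\ltimes_\ell M$ of a finite-dimensional simple Lie algebra $\mathfrak{g}$ over $\mathbb{F}$ and a finite-dimensional completely reducible left $\mathfrak{g}$-module $M$ that does not contain any non-zero trivial $\mathfrak{g}$-submodule.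
   Context: A left Leibniz algebra is an $\mathbb{F}$-vector space $\mathfrak{L}$ with a bilinear multiplication satisfying $x(yz)=(xy)z+y(xz)$ for all $x,y,z\in\mathfrak{L}$. Ideals are two-sided. The Leibniz kernel is the ideal $\mathrm{Leib}(\mathfrak{L}):=\langle x^2\mid x\in\mathfrak{L}\rangle_{\mathbb{F}}$ (the linear span of all squares), and $\mathfrak{L}_{\mathrm{Lie}}:=\mathfrak{L}/\mathrm{Leib}(\mathfrak{L})$ is a Lie algebra, called the canonical Lie algebra of $\mathfrak{L}$. A Leibniz algebra $\mathfrak{L}$ is Lie-simple if $\mathfrak{L}_{\mathrm{Lie}}$ is a simple Lie algebra (non-abelian, with no ideals other than $0$ and itself). A Lie subalgebra of $\mathfrak{L}$ is a subalgebra that is a Lie algebra under the multiplication of $\mathfrak{L}$. A bimodule over a left Leibniz algebra $\mathfrak{L}$ is a vector space $M$ with bilinear left and right actions such that for all $x,y\in\mathfrak{L}$, $m\in M$: $(xy)\cdot m=x\cdot(y\cdot m)-y\cdot(x\cdot m)$, $(x\cdot m)\cdot y=x\cdot(m\cdot y)-m\cdot(xy)$, and $(m\cdot x)\cdot y=m\cdot(xy)-x\cdot(m\cdot y)$. It is anti-symmetric if its right action is zero, and trivial if both actions are zero. A subalgebra $\mathfrak{g}$ of $\mathfrak{L}$ acts on $\mathrm{Leib}(\mathfrak{L})$ by left and right multiplication in $\mathfrak{L}$. A left module is trivial if its left action is zero. A completely reducible (bi)module (direct sum of irreducible ones) is allowed to be zero; irreducible (bi)modules are non-zero. For a Lie algebra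 $\mathfrak{g}$ and a left $\mathfrak{g}$-module $M$, the left hemi-semidirect product $\mathfrak{g}\ltimes_\ell M$ is the left Leibniz algebra with underlying vector space $\mathfrak{g}\times M$ and multiplication $(g,m)(g',m'):=([g,g'],g\cdot m')$. *)

(* Defs.v *)
From HB Require Import structures.
From mathcomp Require Import all_boot all_order all_algebra.
From mathcomp Require Import boolp.
Set Implicit Arguments.
Unset Strict Implicit.
Unset Printing Implicit Defensive.
Import GRing.Theory.
Local Open Scope ring_scope.
Local Open Scope quotient_scope.

Declare Scope leibniz_scope.
Delimit Scope leibniz_scope with L.
Local Open Scope leibniz_scope.

HB.mixin Record Lmodule_isLeftLeibniz (F : fieldType) (L : Type)
    of GRing.Lmodule F L := {
  lmul : L -> L -> L;
  lmul_bilinear : bilinear_for *:%R *:%R lmul;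
  lmul_leibniz : forall x y z : L,
    lmul x (lmul y z) = lmul (lmul x y) z + lmul y (lmul x z)
}.

#[short(type="leibnizType")]
HB.structure Definition LeftLeibniz (F : fieldType) :=
  {L of GRing.Lmodule F L & Lmodule_isLeftLeibniz F L}.

Notation "x ** y" := (lmul x y) (at level 40, left associativity)
  : leibniz_scope.

Section LeibnizTheory.
Context {F : fieldType} {L : leibnizType F}.
Implicit Types x y z : L.

Lemma lmulDl x y z : (x + y) ** z = x ** z + y ** z.
Proof. by have := (lmul_bilinear (s := L)).1 z 1 x y; rewrite /= !scale1r. Qed.

Lemma lmulDr x y z : x ** (y + z) = x ** y + x ** z.
Proof. by have := (lmul_bilinear (s := L)).2 x 1 y z; rewrite /= !scale1r. Qed.

Lemma lmul0l x : 0 ** x = 0.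
Proof. by apply: (@addrI _ (0 ** x)); rewrite -lmulDl !addr0. Qed.

Lemma lmul0r x : x ** 0 = 0.
Proof. by apply: (@addrI _ (x ** 0)); rewrite -lmulDr !addr0. Qed.

Lemma lmulZl (a : F) x y : (a *: x) ** y = a *: (x ** y).
Proof.
by have := (lmul_bilinear (s := L)).1 y a x 0; rewrite /= lmul0l !addr0.
Qed.

Lemma lmulZr (a : F) x y : x ** (a *: y) = a *: (x ** y).
Proof.
by have := (lmul_bilinear (s := L)).2 x a y 0; rewrite /= lmul0r !addr0.
Qed.

Lemma lmulNl x y : (- x) ** y = - (x ** y).
Proof. by rewrite -!scaleN1r lmulZl. Qed.

Lemma lmulNr x y : x ** (- y) = - (x ** y).
Proof. by rewrite -!scaleN1r lmulZr. Qed.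

Lemma lmulBl x y z : (x - y) ** z = x ** z - y ** z.
Proof. by rewrite lmulDl lmulNl. Qed.

Lemma lmulBr x y z : x ** (y - z) = x ** y - x ** z.
Proof. by rewrite lmulDr lmulNr. Qed.

Lemma lmul_sq0 x y : (x ** x) ** y = 0.
Proof. by apply: (@addIr _ (x ** (x ** y))); rewrite -lmul_leibniz add0r. Qed.

End LeibnizTheory.

Definition finite_dimensional (F : fieldType) (V : lmodType F) : Prop :=
  exists n : nat, inhabited (Vector.axiom n V).

(** Subsets are boolean predicates throughout; by [asbool] every [Prop]-valued
    predicate gives one. *)

Definition is_ideal (F : fieldType) (L : leibnizType F) (I : {pred L}) : Prop :=
  submod_closed I /\
  forall x y : L, y \in I -> x ** y \in I /\ y ** x \in I.

Definition is_lie (F : fieldType) (L : leibnizType F) : Prop :=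
  (forall x : L, x ** x = 0) /\
  (forall x y z : L, x ** (y ** z) + y ** (z ** x) + z ** (x ** y) = 0).

Definition simple_lie (F : fieldType) (L : leibnizType F) : Prop :=
  [/\ is_lie L,
      exists x y : L, x ** y <> 0 &
      forall I : {pred L}, is_ideal I -> I =i pred1 0 \/ I =i predT].

Section LeibnizKernel.
Variables (F : fieldType) (L : leibnizType F).

Definition leib : {pred L} := fun x =>
  `[< exists (n : nat) (c : 'I_n -> F) (a : 'I_n -> L),
        x = \sum_(i < n) c i *: (a i ** a i) >].

Lemma leib_sq x : x ** x \in leib.
Proof.
by apply/asboolP; exists 1%N, (fun=> 1), (fun=> x); rewrite big_ord1 scale1r.
Qed.

Lemma leib_submod : submod_closed leib.
Proof.
split=> [|k _ _ /asboolP[m [c [a ->]]] /asboolP[n [d [b ->]]]].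
  by apply/asboolP; exists 0%N, (fun=> 0), (fun=> 0); rewrite big_ord0.
apply/asboolP; exists (m + n)%N.
exists (fun i => match split i with inl j => k * c j | inr j => d j end).
exists (fun i => match split i with inl j => a j | inr j => b j end).
rewrite big_split_ord scaler_sumr /=; congr (_ + _); apply: eq_bigr => i _.
  by rewrite (unsplitK (inl i : 'I_m + 'I_n)) scalerA.
by rewrite (unsplitK (inr i : 'I_m + 'I_n)).
Qed.

HB.instance Definition _ := GRing.isSubmodClosed.Build F L leib leib_submod.

Lemma leib_lmul0 x y : x \in leib -> x ** y = 0.
Proof.
move=> /asboolP[n [c [a ->]]].
elim/big_ind: _ => [|u v u0 v0|i _]; first exact: lmul0l.
  by rewrite lmulDl u0 v0 addr0.
by rewrite lmulZl lmul_sq0 scaler0.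
Qed.

Lemma leib_lmulr x y : y \in leib -> x ** y \in leib.
Proof.
move=> Ly; rewrite -[x ** y](addrK (x ** x)).
have -> : x ** y + x ** x = (x + y) ** (x + y).
  by rewrite lmulDl !lmulDr !(leib_lmul0 _ Ly) !addr0 addrC.
by rewrite rpredB ?leib_sq.
Qed.

Lemma leib_lmull x y : y \in leib -> y ** x \in leib.
Proof. by move=> Ly; rewrite leib_lmul0 // rpred0. Qed.

Lemma leib_ideal : is_ideal leib.
Proof.
by split=> [|x y Ly]; [exact: leib_submod | rewrite leib_lmulr // leib_lmull].
Qed.

End LeibnizKernel.

(** The canonical Lie algebra: the quotient zmodule of the library, with the
    induced scaling and multiplication. *)

Definition canonical_lie (F : fieldType) (L : leibnizType F) : Type :=
  Quotient.quot (@leib F L).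

HB.instance Definition _ (F : fieldType) (L : leibnizType F) :=
  GRing.Zmodule.on (canonical_lie L).

Section CanonicalLie.
Variables (F : fieldType) (L : leibnizType F).
Local Notation Q := (canonical_lie L).

Definition canonical_proj (x : L) : Q := \pi_(Quotient.quot (@leib F L)) x.

Definition canonical_scale (a : F) (u : Q) : Q :=
  canonical_proj (a *: repr (u : Quotient.quot (@leib F L))).

Definition canonical_lmul (u v : Q) : Q :=
  canonical_proj
    (repr (u : Quotient.quot (@leib F L)) ** repr (v : Quotient.quot (@leib F L))).

Lemma canonical_projK (u : Q) :
  canonical_proj (repr (u : Quotient.quot (@leib F L))) = u.
Proof. exact: reprK. Qed.

Lemma canonical_projP x y :
  (canonical_proj x = canonical_proj y) <-> (x - y \in @leib F L).
Proof.
by rewrite /canonical_proj Quotient.idealrBE; exact: (rwP eqP).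
Qed.

Lemma canonical_projD x y :
  canonical_proj (x + y) = canonical_proj x + canonical_proj y.
Proof. by rewrite /canonical_proj raddfD. Qed.

Lemma canonical_proj0 : canonical_proj 0 = 0.
Proof. by rewrite /canonical_proj raddf0. Qed.

Lemma canonical_projZ a x :
  canonical_proj (a *: x) = canonical_scale a (canonical_proj x).
Proof.
apply/canonical_projP; rewrite -scalerBr rpredZ //.
by apply/canonical_projP; rewrite canonical_projK.
Qed.

Lemma canonical_projM x y :
  canonical_proj (x ** y)
    = canonical_lmul (canonical_proj x) (canonical_proj y).
Proof.
apply/canonical_projP.
set x' := repr _; set y' := repr _.
have Lx : x - x' \in @leib F L by apply/canonical_projP; rewrite canonical_projK.
have Ly : y - y' \in @leib F L by apply/canonical_projP; rewrite canonical_projK.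
have -> : x ** y - x' ** y' = (x - x') ** y + x' ** (y - y').
  by rewrite lmulBl lmulBr addrA subrK.
by apply: rpredD; [exact: leib_lmull | exact: leib_lmulr].
Qed.

Lemma canonical_proj_surj (u : Q) : exists x : L, u = canonical_proj x.
Proof. by exists (repr (u : Quotient.quot (@leib F L))); rewrite canonical_projK. Qed.

Fact canonical_scaleA a b u :
  canonical_scale a (canonical_scale b u) = canonical_scale (a * b) u.
Proof.
by have [x ->] := canonical_proj_surj u; rewrite -!canonical_projZ scalerA.
Qed.

Fact canonical_scale1 : left_id 1 canonical_scale.
Proof.
by move=> u; have [x ->] := canonical_proj_surj u;
  rewrite -canonical_projZ scale1r.
Qed.

Fact canonical_scaleDr : right_distributive canonical_scale +%R.
Proof.
move=> a u v; have [x ->] := canonical_proj_surj u.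
have [y ->] := canonical_proj_surj v.
by rewrite -canonical_projD -!canonical_projZ -canonical_projD scalerDr.
Qed.

Fact canonical_scaleDl u : {morph canonical_scale^~ u : a b / a + b}.
Proof.
move=> a b; have [x ->] := canonical_proj_surj u.
by rewrite -!canonical_projZ -canonical_projD scalerDl.
Qed.

HB.instance Definition _ := GRing.Zmodule_isLmodule.Build F Q
  canonical_scaleA canonical_scale1 canonical_scaleDr canonical_scaleDl.

Fact canonical_lmul_bilinear :
  bilinear_for *:%R *:%R (canonical_lmul : Q -> Q -> Q).
Proof.
have projZ a x : a *: canonical_proj x = canonical_proj (a *: x) :> Q.
  by rewrite canonical_projZ.
split=> w a u v; have [x ->] := canonical_proj_surj u;
  have [y ->] := canonical_proj_surj v; have [z ->] := canonical_proj_surj w;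
  rewrite /= -!canonical_projM !projZ -!canonical_projD -canonical_projM.
  by rewrite lmulDl lmulZl.
by rewrite lmulDr lmulZr.
Qed.

Fact canonical_lmul_leibniz (u v w : Q) :
  canonical_lmul u (canonical_lmul v w)
  = canonical_lmul (canonical_lmul u v) w
    + canonical_lmul v (canonical_lmul u w).
Proof.
have [x ->] := canonical_proj_surj u; have [y ->] := canonical_proj_surj v.
have [z ->] := canonical_proj_surj w.
by rewrite -!canonical_projM lmul_leibniz canonical_projD.
Qed.

HB.instance Definition _ := Lmodule_isLeftLeibniz.Build F Q
  canonical_lmul_bilinear canonical_lmul_leibniz.

Lemma canonical_lie_lie : is_lie Q.
Proof.
have sq0 (u : Q) : u ** u = 0.
  have [x ->] := canonical_proj_surj u; rewrite /lmul /= -canonical_projM.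
  by rewrite -canonical_proj0; apply/canonical_projP; rewrite subr0 leib_sq.
have anti (u v : Q) : u ** v = - (v ** u).
  apply/eqP; rewrite -addr_eq0; apply/eqP; have := sq0 (u + v).
  by rewrite lmulDl !lmulDr !sq0 addr0 add0r.
split=> // u v w; rewrite lmul_leibniz (anti w u) lmulNr (anti w (u ** v)).
by rewrite addrK subrr.
Qed.

End CanonicalLie.

Definition lie_simple (F : fieldType) (L : leibnizType F) : Prop :=
  simple_lie (canonical_lie L).

Record subalgebra (F : fieldType) (L : leibnizType F) := Subalgebra {
  subalg_pred : {pred L};
  subalg_submod : submod_closed subalg_pred;
  subalg_lmul : {in subalg_pred &, forall x y : L, x ** y \in subalg_pred}
}.

Section SubalgebraType.
Variables (F : fieldType) (L : leibnizType F) (g : subalgebra L).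

HB.instance Definition _ :=
  GRing.isSubmodClosed.Build F L (subalg_pred g) (@subalg_submod F L g).

Definition subalg : Type := {x : L | x \in subalg_pred g}.

HB.instance Definition _ := SubChoice.on subalg.
HB.instance Definition _ := [SubChoice_isSubLmodule of subalg by <:].

Definition subalg_mul (x y : subalg) : subalg :=
  Sub (val x ** val y) (@subalg_lmul F L g _ _ (valP x) (valP y)).

Fact subalg_mul_bilinear : bilinear_for *:%R *:%R subalg_mul.
Proof.
split=> z a x y; apply: val_inj => /=.
  by rewrite lmulDl lmulZl.
by rewrite lmulDr lmulZr.
Qed.

Fact subalg_mul_leibniz x y z :
  subalg_mul x (subalg_mul y z)
  = subalg_mul (subalg_mul x y) z + subalg_mul y (subalg_mul x z).
Proof. by apply: val_inj; rewrite raddfD !SubK lmul_leibniz. Qed.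

HB.instance Definition _ := Lmodule_isLeftLeibniz.Build F subalg
  subalg_mul_bilinear subalg_mul_leibniz.

Lemma val_lmul (x y : subalg) : val (x ** y) = val x ** val y.
Proof. by []. Qed.

End SubalgebraType.

Section LeibnizKernelType.
Variables (F : fieldType) (L : leibnizType F).

Definition leib_type : Type := {x : L | x \in @leib F L}.

HB.instance Definition _ := SubChoice.on leib_type.
HB.instance Definition _ := [SubChoice_isSubLmodule of leib_type by <:].

End LeibnizKernelType.

Definition vs_direct_sum (F : fieldType) (V : lmodType F) (A B : {pred V}) :=
  (forall v : V, exists a b : V, [/\ a \in A, b \in B & v = a + b]) /\
  (forall v : V, v \in A -> v \in B -> v = 0).

Record bimodule (F : fieldType) (g : leibnizType F) := Bimodule {
  bimod_sort :> lmodType F;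
  lact : g -> bimod_sort -> bimod_sort;
  ract : bimod_sort -> g -> bimod_sort;
  lact_bilinear : bilinear_for *:%R *:%R lact;
  ract_bilinear : bilinear_for *:%R *:%R ract;
  bimod_LLM : forall (x y : g) (m : bimod_sort),
    lact (x ** y) m = lact x (lact y m) - lact y (lact x m);
  bimod_LML : forall (x y : g) (m : bimod_sort),
    ract (lact x m) y = lact x (ract m y) - ract m (x ** y);
  bimod_MLL : forall (x y : g) (m : bimod_sort),
    ract (ract m x) y = ract m (x ** y) - lact x (ract m y)
}.

Record left_module (F : fieldType) (g : leibnizType F) := LeftModule {
  lmod_sort :> lmodType F;
  left_act : g -> lmod_sort -> lmod_sort;
  left_act_bilinear : bilinear_for *:%R *:%R left_act;
  left_act_lmul : forall (x y : g) (m : lmod_sort),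
    left_act (x ** y) m = left_act x (left_act y m) - left_act y (left_act x m)
}.

Section Submodules.
Variables (F : fieldType) (g : leibnizType F).

Definition subbimodule (M : bimodule g) (N : {pred M}) : Prop :=
  submod_closed N /\
  forall (x : g) (m : M), m \in N -> lact x m \in N /\ ract m x \in N.

Definition antisymmetric_bimodule (M : bimodule g) : Prop :=
  forall (m : M) (x : g), ract m x = 0.

Definition trivial_on_bi (M : bimodule g) (N : {pred M}) : Prop :=
  forall (x : g) (m : M), m \in N -> lact x m = 0 /\ ract m x = 0.

Definition left_submodule (M : left_module g) (N : {pred M}) : Prop :=
  submod_closed N /\ forall (x : g) (m : M), m \in N -> left_act x m \in N.

Definition trivial_on_left (M : left_module g) (N : {pred M}) : Prop :=
  forall (x : g) (m : M), m \in N -> left_act x m = 0.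

End Submodules.

(** Complete reducibility is stated once for both kinds of modules: the
    parameter [sub] is [@subbimodule _ _ M] or [@left_submodule _ _ M]. *)

Section CompleteReducibility.
Variables (F : fieldType) (V : lmodType F) (sub : {pred V} -> Prop).

Definition irreducible_sub (N : {pred V}) : Prop :=
  [/\ sub N, ~ (N =i pred1 0) &
      forall N' : {pred V}, sub N' -> {subset N' <= N} ->
        N' =i pred1 0 \/ N' =i N].

Definition is_direct_sum (I : eqType) (N : I -> {pred V}) : Prop :=
  (forall v : V, exists (s : seq I) (f : I -> V),
     [/\ uniq s, {in s, forall i, f i \in N i} & v = \sum_(i <- s) f i]) /\
  (forall (s : seq I) (f : I -> V),
     uniq s -> {in s, forall i, f i \in N i} ->
     \sum_(i <- s) f i = 0 -> {in s, forall i, f i = 0}).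

Definition completely_reducible_for : Prop :=
  exists (I : eqType) (N : I -> {pred V}),
    (forall i, irreducible_sub (N i)) /\ is_direct_sum N.

End CompleteReducibility.

Definition completely_reducible_bi (F : fieldType) (g : leibnizType F)
  (M : bimodule g) := completely_reducible_for (@subbimodule F g M).

Definition completely_reducible_left (F : fieldType) (g : leibnizType F)
  (M : left_module g) := completely_reducible_for (@left_submodule F g M).

Section LeibBimodule.
Variables (F : fieldType) (L : leibnizType F) (g : subalgebra L).
Implicit Types (x y : subalg g) (m : leib_type L).

Definition leib_lact x m : leib_type L :=
  Sub (val x ** val m) (leib_lmulr (val x) (valP m)).

Definition leib_ract m x : leib_type L :=
  Sub (val m ** val x) (leib_lmull (val x) (valP m)).

Fact leib_lact_bilinear : bilinear_for *:%R *:%R leib_lact.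
Proof.
split=> z a x y; apply: val_inj => /=.
  by rewrite lmulDl lmulZl.
by rewrite lmulDr lmulZr.
Qed.

Fact leib_ract_bilinear : bilinear_for *:%R *:%R leib_ract.
Proof.
split=> z a x y; apply: val_inj => /=.
  by rewrite lmulDl lmulZl.
by rewrite lmulDr lmulZr.
Qed.

Fact leib_LLM x y m :
  leib_lact (x ** y) m
  = leib_lact x (leib_lact y m) - leib_lact y (leib_lact x m).
Proof. by apply: val_inj; rewrite raddfB /= ?val_lmul lmul_leibniz addrK. Qed.

Fact leib_LML x y m :
  leib_ract (leib_lact x m) y
  = leib_lact x (leib_ract m y) - leib_ract m (x ** y).
Proof. by apply: val_inj; rewrite raddfB /= ?val_lmul lmul_leibniz addrK. Qed.

Fact leib_MLL x y m :
  leib_ract (leib_ract m x) y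
  = leib_ract m (x ** y) - leib_lact x (leib_ract m y).
Proof. by apply: val_inj; rewrite raddfB /= ?val_lmul lmul_leibniz addrK. Qed.

Definition leib_bimodule : bimodule (subalg g) :=
  Bimodule leib_lact_bilinear leib_ract_bilinear leib_LLM leib_LML leib_MLL.

End LeibBimodule.

Definition hemisemidirect (F : fieldType) (g : leibnizType F)
  (M : left_module g) : Type := (g * M)%type.

Section HemiSemidirect.
Variables (F : fieldType) (g : leibnizType F) (M : left_module g).
Local Notation H := (hemisemidirect M).

HB.instance Definition _ := GRing.Lmodule.copy H (g * M)%type.

Definition hemi_mul (u v : H) : H := (u.1 ** v.1, left_act u.1 v.2).

Fact hemi_mul_bilinear : bilinear_for *:%R *:%R hemi_mul.
Proof.
split=> [[z n] a [x l] [y m]|[z n] a [x l] [y m]].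
  congr pair; first by rewrite /= lmulDl lmulZl.
  exact: (left_act_bilinear M).1.
congr pair; first by rewrite /= lmulDr lmulZr.
exact: (left_act_bilinear M).2.
Qed.

Fact hemi_mul_leibniz u v w :
  hemi_mul u (hemi_mul v w)
  = hemi_mul (hemi_mul u v) w + hemi_mul v (hemi_mul u w).
Proof.
have E : left_act u.1 (left_act v.1 w.2) = left_act (u.1 ** v.1) w.2 + left_act v.1 (left_act u.1 w.2).
  by rewrite left_act_lmul subrK.
exact: (congr2 (@pair g M) (lmul_leibniz u.1 v.1 w.1) E).
Qed.

HB.instance Definition _ := Lmodule_isLeftLeibniz.Build F H
  hemi_mul_bilinear hemi_mul_leibniz.

End HemiSemidirect.

Definition leibniz_isomorphic (F : fieldType) (L L' : leibnizType F) : Prop :=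
  exists f : {linear L -> L'}, bijective f /\ {morph f : x y / x ** y}.

(* Main.v *)
From HB Require Import structures.
Require Import Defs.
From mathcomp Require Import all_boot all_order all_algebra.
From mathcomp Require Import fieldext boolp ring.
Set Implicit Arguments.
Unset Strict Implicit.
Unset Printing Implicit Defensive.
Import GRing.Theory.
Local Open Scope ring_scope.
Local Open Scope leibniz_scope.

(** Left multiplication by an element of Leib(L) is zero, so L is a left module
    over its canonical Lie algebra g, with Leib(L) a submodule. If g is simple,
    Weyl's theorem yields a complementary submodule of L; being stable under all
    left multiplications it is a subalgebra, isomorphic to g. For a = x + m with x
    in this subalgebra and m in Leib(L), a a = x m; hence Leib(L) = g Leib(L), and
    no trivial summand can occur.

    Weyl's theorem over an arbitrary field of characteristic zero is derived from
    Whitehead's first lemma, through the Casimir element and Fitting decompositions.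
    The nondegeneracy of trace forms is Cartan's criterion: over a splitting field,
    an element of a simple g with vanishing trace form acts nilpotently, and by
    Engel's argument this cannot hold for all elements of g. *)

(** * Matrices and interpolation *)

(** Over an arbitrary [F] the eigenvalues needed for Cartan's criterion lie in an extension, over
    which a simple [g] may cease to be simple. So only matrices are extended, to a splitting field
    of a single characteristic polynomial, while every argument with ideals takes place in [g] over
    [F]. The extension carries no conjugation either; eigenvalues are therefore paired with their
    images under [rat]-linear maps to [rat], where a weighted sum of squares vanishes only
    trivially. Schur's lemma is avoided as well: the Casimir element of a non-zero action need not
    be scalar, but its trace is the dimension of [g], non-zero in characteristic zero. Hence it is
    not nilpotent, and its Fitting part splits off a non-zero submodule on which it is
    invertible. *)

Lemma expr_mulmxC (F : fieldType) m n (R : 'M[F]_(m, n)) (C : 'M[F]_(n, m)) k :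
  (R *m C) ^+ k.+1 = R *m (C *m R) ^+ k *m C.
Proof.
elim: k => [|k IHk]; first by rewrite expr1 expr0 mulmx1.
by rewrite exprS IHk [(C *m R) ^+ k.+1]exprS -!mulmxE !mulmxA.
Qed.

(* For a full rank factorization [N = C *m R], [R *m C] is a smaller nilpotent
   matrix with the same trace. *)
Lemma mxtrace_nilpotent (F : fieldType) n (N : 'M[F]_n) k :
  N ^+ k = 0 -> \tr N = 0.
Proof.
elim/ltn_ind: n N k => n IHn N k Nk0.
have [n0|n_gt0] := posnP n.
  by subst n; rewrite /mxtrace big_ord0.
have [rN|] := ltnP (\rank N) n; last first.
  move=> fullN; have uN : N \in unitmx.
    by rewrite -row_free_unit /row_free eqn_leq rank_leq_row.
  have : N ^+ k \in unitmx.
    elim: {Nk0} k => [|k IHk]; first by rewrite expr0 unitmx1.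
    by rewrite exprS unitmx_mul uN.
  rewrite Nk0 -row_free_unit /row_free mxrank0 => /eqP n0.
  by rewrite -n0 in n_gt0.
rewrite -[N]mulmx_base mxtrace_mulC (IHn _ rN _ k.+1) //.
by rewrite expr_mulmxC mulmx_base Nk0 mulmx0 mul0mx.
Qed.

(** In a full rank factorization [E = C *m R], idempotence cancels to [R *m C = 1%:M], of size
    [\rank E], and the trace is cyclic. *)
Lemma mxtrace_idem (F : fieldType) n (E : 'M[F]_n) :
  E *m E = E -> \tr E = (\rank E)%:R.
Proof.
move=> idE; rewrite -{1}[E]mulmx_base mxtrace_mulC.
suff -> : row_base E *m col_base E = 1%:M by rewrite mxtrace1.
have fC : row_full (col_base E) by exact: col_base_full.
have fR : row_free (row_base E) by exact: row_base_free.
have : col_base E *m (row_base E *m col_base E) *m row_base E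
    = col_base E *m 1%:M *m row_base E.
  by rewrite mulmxA -mulmxA !mulmx_base mulmx1 mulmx_base.
move=> /(row_free_inj fR)/(row_full_inj fC); exact.
Qed.

Lemma coprimep_XsubC_exp_prod (K : fieldType) (s : seq K) (z : K) N :
  z \notin s -> coprimep (('X - z%:P) ^+ N) (\prod_(w <- s) ('X - w%:P) ^+ N).
Proof.
elim: s => [|w s IHs]; first by rewrite big_nil coprimep1.
rewrite inE negb_or => /andP[zw z_s]; rewrite big_cons coprimepMr IHs // andbT.
by rewrite coprimep_expl // coprimep_expr // coprimep_XsubC root_XsubC eq_sym.
Qed.

(** Chinese remainder theorem, one root at a time: [a * Q] is 1 modulo the new power and 0 modulo
    the old ones, so the correction keeps the old congruences. *)
Lemma hermite_interpolation (K : fieldType) (s : seq K) (c : K -> K) N :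
  uniq s -> exists p : {poly K}, {in s, forall z, ('X - z%:P) ^+ N %| p - (c z)%:P}.
Proof.
elim: s => [_|z s IHs /andP[z_s /IHs[p pP]]]; first by exists 0.
pose Q : {poly K} := \prod_(w <- s) ('X - w%:P) ^+ N.
have : coprimep Q (('X - z%:P) ^+ N) by rewrite coprimep_sym coprimep_XsubC_exp_prod.
case/Bezout_eq1_coprimepP => -[a b] /= ab1.
exists (p + ((c z)%:P - p) * a * Q) => w; rewrite inE => /orP[/eqP->|sw].
  have -> : p + ((c z)%:P - p) * a * Q - (c z)%:P = (p - (c z)%:P) * (b * ('X - z%:P) ^+ N).
    have -> : b * ('X - z%:P) ^+ N = 1 - a * Q by rewrite -ab1 [a * Q + _]addrC addrK.
    ring.
  by rewrite mulrA dvdp_mull.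
rewrite addrAC dvdp_add ?pP // dvdp_mull //.
by rewrite /Q (big_rem w sw) /= dvdp_mulr.
Qed.

Lemma dvdp_prod_XsubC_exp (K : fieldType) (s : seq K) (p : {poly K}) N :
  uniq s -> {in s, forall z, ('X - z%:P) ^+ N %| p} ->
  \prod_(z <- s) ('X - z%:P) ^+ N %| p.
Proof.
elim: s => [|z s IHs]; first by rewrite big_nil dvd1p.
move=> /andP[z_s us] dv; rewrite big_cons Gauss_dvdp.
  by rewrite dv ?mem_head //= IHs // => w sw; rewrite dv // inE sw orbT.
exact: coprimep_XsubC_exp_prod.
Qed.

(* [E] is the Fitting projector onto the part where [C] is invertible, and [D] is
   the inverse of [C] there. *)
Lemma fitting (F : fieldType) n (C : 'M[F]_n) :
  exists D E : 'M[F]_n,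
    [/\ D *m C = E, E *m E = E, exists k, C ^+ k *m (1%:M - E) = 0,
        forall B, comm_mx B C -> comm_mx B D & forall B, comm_mx B C -> comm_mx B E].
Proof.
case: n C => [|n] C.
  exists 0, 0; split; rewrite ?mul0mx //.
  - by exists 0%N; exact: flatmx0.
  - by move=> B _; rewrite /comm_mx mulmx0 mul0mx.
  - by move=> B _; rewrite /comm_mx mulmx0 mul0mx.
(* The extra factor ['X] makes 0 a root even when [C] is invertible, so that [k > 0] and ['X^(k.-1)]
   makes sense below. *)
pose p := 'X * char_poly C.
have p0 : p != 0 by rewrite mulf_neq0 ?polyX_eq0 // monic_neq0 ?char_poly_monic.
have [k [q q0 pE]] := multiplicity_XsubC p 0.
rewrite subr0 p0 /= in q0 pE.
have k0 : (0 < k)%N.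
  rewrite lt0n; apply: contraL q0 => /eqP k0.
  by rewrite negbK; move: pE; rewrite k0 mulr1 => <-; rewrite /root hornerM hornerX mul0r.
have pC : horner_mx C p = 0 by rewrite rmorphM /= Cayley_Hamilton mulr0.
have : coprimep ('X ^+ k) q.
  by rewrite coprimep_sym coprimep_expr // -(subr0 'X) -polyC0 coprimep_XsubC.
case/Bezout_eq1_coprimepP => -[u w] /= uw1.
(* [u * 'X^k] is 0 modulo ['X^k] and 1 modulo [q], hence idempotent modulo [p], which annihilates
   [C]. *)
exists (horner_mx C (u * 'X^(k.-1))), (horner_mx C (u * 'X^k)); split.
- rewrite -{2}[C](horner_mx_X C) -[_ *m _]/(_ * _) -rmorphM -mulrA -exprSr.
  by rewrite prednK.
- rewrite -[_ *m _]/(_ * _) -rmorphM; apply/eqP; rewrite -subr_eq0 -rmorphB /=.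
  have -> : u * 'X^k * (u * 'X^k) - u * 'X^k = - (u * w) * p.
    have w1 : w * q = 1 - u * 'X^k by rewrite -uw1 [u * _ + _]addrC addrK.
    have -> : - (u * w) * p = - (u * 'X^k) * (w * q) by rewrite pE; ring.
    by rewrite w1; ring.
  by rewrite rmorphM /= pC mulr0.
- exists k; rewrite -{1}[C](horner_mx_X C) -rmorphXn /= -[1%:M](rmorph1 (horner_mx C)).
  rewrite -rmorphB -[_ *m _]/(_ * _) -rmorphM /=.
  have -> : 'X^k * (1 - u * 'X^k) = w * p.
    by rewrite -uw1 [u * _ + _]addrC addrK pE; ring.
  by rewrite rmorphM /= pC mulr0.
- by move=> B BC; apply: comm_mx_horner.
- by move=> B BC; apply: comm_mx_horner.
Qed.

(** The projectors onto the generalized eigenspaces are values at [A] of polynomials that are 1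
    modulo [('X - z%:P) ^+ N] and 0 modulo the powers at the other roots. *)
Lemma spectral_idempotents (K : fieldType) n (A : 'M[K]_n) (s : seq K) :
    char_poly A = \prod_(z <- s) ('X - z%:P) ->
  exists k (a : 'I_k -> K) (E : 'I_k -> 'M[K]_n) N,
    [/\ \sum_i E i = 1%:M,
        forall i, (0 < \rank (E i))%N /\ E i *m E i = E i,
        forall i, comm_mx A (E i),
        forall i, (A - (a i)%:M) ^+ N *m E i = 0 &
        forall i, E i *m (A - (a i)%:M) ^+ N = 0].
Proof.
case: n A => [|n] A chiA.
  exists 0%N, (fun=> 0), (fun=> 0), 0%N.
  by split=> [|[]|[]|[]|[]] //; rewrite big_ord0 [RHS]flatmx0.
(* [size s] bounds all multiplicities, so a polynomial divisible by every [('X - z%:P) ^+ N] is a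
   multiple of [char_poly A]. *)
pose t := undup s; pose N := size s.
have kill p : {in t, forall z, ('X - z%:P) ^+ N %| p} -> horner_mx A p = 0.
  move=> /(dvdp_prod_XsubC_exp (undup_uniq s)) tp.
  suff /dvdp_trans/(_ tp)/dvdpP[q ->] : char_poly A %| \prod_(z <- t) ('X - z%:P) ^+ N.
    by rewrite rmorphM /= Cayley_Hamilton mulr0.
  rewrite chiA /t /N -big_undup_iterop_count /= big_seq [X in _ %| X]big_seq.
  apply: (big_ind2 (fun p q => p %| q)) => // [*|z sz]; first exact: dvdp_mul.
  exact/dvdp_exp2l/count_size.
have [e eP] := boolp.choice
  (fun z => hermite_interpolation (fun w => (w == z)%:R) N (undup_uniq s)).
(* Any vanishing projector is discarded: the ranks are to serve as positive weights. *)
pose r := [seq z <- t | horner_mx A (e z) != 0].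
have ur : uniq r by rewrite filter_uniq // undup_uniq.
have rP i : (i < size r)%N -> nth 0 r i \in t /\ horner_mx A (e (nth 0 r i)) != 0.
  by move=> /(mem_nth 0); rewrite mem_filter => /andP[].
have EN z : z \in t -> (A - z%:M) ^+ N *m horner_mx A (e z) = 0.
  move=> tz; have -> : A - z%:M = horner_mx A ('X - z%:P).
    by rewrite rmorphB /= horner_mx_X horner_mx_C.
  rewrite -rmorphXn -[_ *m _]/(_ * _) -rmorphM; apply: kill => w tw.
  have [->|wz] := eqVneq w z; first exact: dvdp_mulr.
  by have := eP z w tw; rewrite (negPf wz) subr0; apply: dvdp_mull.
exists (size r), (fun i => nth 0 r i), (fun i => horner_mx A (e (nth 0 r i))), N.
have EA z B : comm_mx A B -> comm_mx (horner_mx A (e z)) B by apply: comm_horner_mx.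
split=> [|i|i|i|i].
- rewrite -(big_mkord xpredT (fun i => horner_mx A (e (nth 0 r i)))).
  rewrite -(big_nth 0 xpredT (fun z => horner_mx A (e z))) big_filter.
  rewrite big_mkcond /= (eq_bigr (fun z => horner_mx A (e z))); last first.
    by move=> z _; case: eqP.
  rewrite -rmorph_sum /=; apply/eqP; rewrite -subr_eq0; apply/eqP.
  rewrite -[1%:M](rmorph1 (horner_mx A)) -rmorphB; apply: kill => w tw.
  have -> : \sum_(z <- t) e z - 1 = \sum_(z <- t) (e z - ((w == z)%:R)%:P).
    rewrite sumrB; congr (_ - _); rewrite (bigD1_seq w) ?undup_uniq //= eqxx big1 ?addr0 //.
    by move=> z; rewrite eq_sym => /negPf->.
  rewrite big_seq; apply: (big_ind (fun p => _ %| p)) => [|p q|z tz]; first exact: dvdp0.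
    exact: dvdp_add.
  exact: eP.
- have [ti ri] := rP i (ltn_ord i); split; first by rewrite lt0n mxrank_eq0.
  rewrite -[_ *m _]/(_ * _) -rmorphM; apply/eqP; rewrite -subr_eq0 -rmorphB.
  apply/eqP/kill => w tw; set z := nth 0 r i.
  have [wz|wz] := eqVneq w z.
    rewrite -{3}[e z]mulr1 -mulrBr dvdp_mull //.
    by have := eP z w tw; rewrite wz eqxx.
  have := eP z w tw; rewrite (negPf wz) subr0 => dv.
  by rewrite dvdp_sub // dvdp_mulr.
- exact/comm_mx_sym/EA.
- by have [] := rP i (ltn_ord i); move/EN.
- have [ti _] := rP i (ltn_ord i).
  rewrite -[RHS](EN _ ti) [LHS]EA //.
  have: comm_mx A (A - (nth 0 r i)%:M).
    by apply: comm_mxB => //; exact: comm_mx_scalar.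
  elim: N {EN kill eP} => [|j IHj] cA; first by rewrite expr0; apply: comm_mx1.
  by rewrite exprS; apply: comm_mxM => //; exact: IHj.
Qed.

(** * Splitting fields and rational relations *)

Lemma irreducible_factor (F : fieldType) (p : {poly F}) :
  (1 < size p)%N -> exists2 q, irreducible_poly q & q %| p.
Proof.
move=> p1; have p0 : p != 0 by rewrite -size_poly_gt0 ltnW.
pose P k := `[< exists q : {poly F}, [/\ size q = k, (1 < k)%N & q %| p] >].
have exP : exists k, P k by exists (size p); apply/asboolP; exists p.
case: (ex_minnP exP) => k /asboolP[q [qk k1 qp]] kmin; exists q => //.
split=> [|r r1 rq]; first by rewrite qk.
have q0 : q != 0 by apply: contraTneq qp => ->; rewrite dvd0p.
have r0 : r != 0 by apply: contraTneq rq => ->; rewrite dvd0p.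
rewrite -dvdp_size_eqp // eqn_leq dvdp_leq //= qk; apply: kmin.
apply/asboolP; exists r; split; last exact: dvdp_trans qp.
  by [].
by rewrite ltn_neqAle eq_sym r1 size_poly_gt0.
Qed.

Lemma splitting_field (F : fieldType) (p : {poly F}) : p \is monic ->
  exists (K : fieldType) (i : {rmorphism F -> K}) (s : seq K),
    map_poly i p = \prod_(z <- s) ('X - z%:P).
Proof.
have [n] := ubnP (size p); elim: n F p => // n IHn F p pn mon_p.
have [p1|p1] := leqP (size p) 1.
  exists F, idfun, [::]; rewrite map_poly_id // big_nil.
  have /size_poly1P[c c0 pE] : size p == 1%N.
    by rewrite eqn_leq p1 size_poly_gt0 monic_neq0.
  by move: mon_p; rewrite pE monicE lead_coefC => /eqP->.
have [q irr_q qp] := irreducible_factor p1.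
have [L _ [z qz _]] := irredp_FAdjoin irr_q.
have /factor_theorem[r rE] : root (map_poly (in_alg L) p) z.
  have /dvdpP[t ->] := qp.
  by rewrite rmorphM /= rootM qz orbT.
have mon_r : r \is monic.
  by rewrite -(monicMr _ (monicXsubC z)) -rE map_monic.
have [|K [i [s sE]]] := IHn L r _ mon_r.
  have : size (map_poly (in_alg L) p) = (size r).+1.
    by rewrite rE size_Mmonic ?monic_neq0 ?monicXsubC // size_XsubC addn2.
  by rewrite size_map_poly => E; rewrite -ltnS -E.
exists K, (i \o in_alg L), (i z :: s).
by rewrite map_poly_comp rE rmorphM /= sE big_cons mulrC rmorphB /= map_polyX map_polyC.
Qed.

Lemma map_pchar0 (F K : fieldType) (i : {rmorphism F -> K}) :
  [pchar F] =i pred0 -> [pchar K] =i pred0.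
Proof. by move=> F0 p; rewrite (fmorph_pchar i) F0. Qed.

Section RatrChar0.
Variables (K : fieldType) (K0 : [pchar K] =i pred0).

Lemma intr_eq0_pchar0 (m : int) : (m%:~R == 0 :> K) = (m == 0).
Proof.
case: m => n; first by rewrite -pmulrn ((pcharf0P K).1 K0).
by rewrite NegzE mulrNz oppr_eq0 -pmulrn ((pcharf0P K).1 K0).
Qed.

Let nz_den (x : rat) : (denq x)%:~R != 0 :> K.
Proof. by rewrite intr_eq0_pchar0 denq_eq0. Qed.

(** [ratr] is computed from the reduced fraction; evaluating it on any fraction spares the reduction
    of sums and products. *)
Lemma ratrE_pchar0 (x : rat) (m d : int) :
  d != 0 -> x * d%:~R = m%:~R -> ratr x = m%:~R / d%:~R :> K.
Proof.
move=> d0 xd; apply/eqP; rewrite /ratr eqr_div ?intr_eq0_pchar0 ?denq_eq0 //.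
rewrite -!intrM; apply/eqP; congr (_ %:~R); apply: (@intr_inj rat).
by rewrite !intrM -xd numqE mulrAC.
Qed.

Lemma ratrD_pchar0 (x y : rat) : ratr (x + y) = ratr x + ratr y :> K.
Proof.
rewrite (@ratrE_pchar0 _ (numq x * denq y + numq y * denq x) (denq x * denq y)).
- by rewrite intrM intrD !intrM /ratr addf_div.
- by rewrite mulf_neq0 ?denq_eq0.
- by rewrite !intrD !intrM !numqE mulrDl; ring.
Qed.

Lemma ratrM_pchar0 (x y : rat) : ratr (x * y) = ratr x * ratr y :> K.
Proof.
rewrite (@ratrE_pchar0 _ (numq x * numq y) (denq x * denq y)).
- by rewrite !intrM /ratr mulf_div.
- by rewrite mulf_neq0 ?denq_eq0.
- by rewrite !intrM !numqE; ring.
Qed.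

End RatrChar0.

(** A matrix of maximal rank with row space inside [P] already captures [P]: adding a vector of [P]
    cannot raise the rank. *)
Lemma submod_rowspace (F : fieldType) n (P : {pred 'rV[F]_n}) :
  submod_closed P -> exists A : 'M[F]_n, forall v, (v \in P) = (v <= A)%MS.
Proof.
move=> [P0 Plin].
pose Q k := `[< exists A : 'M[F]_n, \rank A = k /\ forall v, (v <= A)%MS -> v \in P >].
have exQ : exists k, Q k.
  by exists 0%N; apply/asboolP; exists 0; split=> [|v /[!submx0]/eqP->]; rewrite ?mxrank0.
have ubQ k : Q k -> (k <= n)%N by move=> /asboolP[A [<- _]]; exact: rank_leq_row.
case: (ex_maxnP exQ ubQ) => k /asboolP[A [Ak AP]] kmax; exists A => v.
apply/idP/idP => [Pv|]; last exact: AP.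
have /kmax rle : Q (\rank (A + v)%MS).
  apply/asboolP; exists (A + v)%MS; split=> // u /sub_addsmxP[[u1 u2] /= ->].
  by rewrite addrC [u2]mx11_scalar mul_scalar_mx Plin // AP // submxMl.
have : (A + v <= A)%MS.
  by rewrite -(geq_leqif (mxrank_leqif_sup (addsmxSl A v))) Ak; exact: rle.
exact/submx_trans/addsmxSr.
Qed.

(* The rational vectors orthogonal to all rational relations between the [a i]
   are the values [m i = f (a i)] of the [rat]-linear maps
   [f : <a_0, ..., a_(k-1)> -> rat]. *)
Lemma orthogonal_relations_eq0 (K : fieldType) k (a : 'I_k -> K) (w : 'I_k -> nat) :
    [pchar K] =i pred0 -> (forall i, 0 < w i)%N ->
    (forall m : 'I_k -> rat,
       (forall c : 'I_k -> rat, \sum_i ratr (c i) * a i = 0 -> \sum_i c i * m i = 0) ->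
       \sum_i ratr (m i) * (a i *+ w i) = 0) ->
  forall i, a i = 0.
Proof.
move=> K0 w0 orth.
pose R := [pred v : 'rV[rat]_k | \sum_i ratr (v 0 i) * a i == 0].
have ratr0 : ratr 0 = 0 :> K by rewrite (ratr_nat K 0).
have [|Z ZP] := @submod_rowspace _ _ R.
  split=> [|c u v]; first by rewrite inE big1 // => i _; rewrite mxE ratr0 mul0r.
  rewrite !inE => /eqP u0 /eqP v0.
  under eq_bigr do rewrite !mxE (ratrD_pchar0 K0) (ratrM_pchar0 K0) mulrDl -mulrA.
  by rewrite big_split -mulr_sumr /= u0 v0 mulr0 addr0.
(* A vector [m] orthogonal to all relations yields by [orth] the relation with coefficients
   [m 0 i *+ w i]. Its orthogonality to [m] is the vanishing of a sum of squares with positive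
   weights, so [m = 0]. *)
have ker0 : kermx Z^T = 0.
  apply/row_matrixP => j; rewrite row0; set m := row j _.
  have mZ : m *m Z^T = 0 by rewrite -row_mul mulmx_ker row0.
  have : \sum_i m 0 i * m 0 i *+ w i == 0.
    have wm0 : \sum_i ratr (m 0 i) * (a i *+ w i) = 0.
      apply: (orth (fun i => m 0 i)) => c c0; have : (\row_i c i <= Z)%MS.
        by rewrite -ZP inE; under eq_bigr do rewrite mxE; rewrite c0.
      move=> /submxP[t tE].
      have /matrixP/(_ 0 0) : (\row_i c i) *m m^T = 0.
        by rewrite tE -mulmxA -[Z]trmxK -trmx_mul mZ trmx0 mulmx0.
      by rewrite !mxE => E; rewrite -[RHS]E; apply: eq_bigr => i _; rewrite !mxE.
    have : (\row_i (m 0 i *+ w i) <= Z)%MS.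
      rewrite -ZP inE; apply/eqP; rewrite -[RHS]wm0; apply: eq_bigr => i _.
      rewrite mxE -mulr_natr (ratrM_pchar0 K0) ratr_nat -mulrA; congr (_ * _).
      by rewrite mulr_natl.
    move=> /submxP[t tE].
    have /matrixP/(_ 0 0) : (\row_i (m 0 i *+ w i)) *m m^T = 0.
      by rewrite tE -mulmxA -[Z]trmxK -trmx_mul mZ trmx0 mulmx0.
    rewrite !mxE => E; apply/eqP; rewrite -[RHS]E; apply: eq_bigr => i _.
    by rewrite !mxE mulrnAl.
  rewrite Num.Theory.psumr_eq0 => [/allP mw|i _]; last first.
    by rewrite Num.Theory.mulrn_wge0 // -expr2 Num.Theory.sqr_ge0.
  apply/rowP => i; have := mw i (mem_index_enum _).
  rewrite /= Num.Theory.mulrn_eq0 mulf_eq0 orbb -leqn0 leqNgt w0 /= => /eqP ->.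
  by rewrite mxE.
(* Now every rational vector is a relation, and the unit vector at [i] reads [a i = 0]. *)
have fullZ : row_full Z by move/eqP: ker0; rewrite kermx_eq0 /row_free mxrank_tr.
move=> i; have : ((delta_mx 0 i : 'rV_k) <= Z)%MS by exact: submx_full.
rewrite -ZP inE (bigD1 i) //= mxE !eqxx big1 => [|j ji]; last first.
  by rewrite mxE (negPf ji) ratr0 mul0r.
by rewrite (ratr_nat K 1) mul1r addr0 => /eqP.
Qed.

(** * Cartan's criterion *)

Section PolyAct.
Variables (K : fieldType) (V : lmodType K) (T : {linear V -> V}).
Implicit Types (p q : {poly K}) (v : V).

(** This is [p(T) v]. Iterates replace matrix powers so that [T] can be a commutator map on matrices
    without a matrix of its own. *)
Definition polyact p v := \sum_(i < size p) p`_i *: iter i T v.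

Lemma polyact_wide k p v : (size p <= k)%N ->
  polyact p v = \sum_(i < k) p`_i *: iter i T v.
Proof.
move=> pk; rewrite /polyact (big_ord_widen _ (fun i => p`_i *: iter i T v) pk).
rewrite big_mkcond; apply: eq_bigr => i _; case: ltnP => // pi.
by rewrite nth_default ?scale0r.
Qed.

Lemma polyactD p q v : polyact (p + q) v = polyact p v + polyact q v.
Proof.
pose k := maxn (size p) (size q).
rewrite !(@polyact_wide k) ?leq_maxl ?leq_maxr ?size_polyD //.
by rewrite -big_split /=; apply: eq_bigr => i _; rewrite coefD scalerDl.
Qed.

Lemma polyactC c v : polyact c%:P v = c *: v.
Proof. by rewrite (@polyact_wide 1) ?size_polyC ?leq_b1 // big_ord1 coefC. Qed.

Lemma polyact0r p : polyact p 0 = 0.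
Proof.
rewrite /polyact big1 // => i _.
have -> : iter i T 0 = 0 by elim: (i : nat) => //= j ->; rewrite linear0.
exact: scaler0.
Qed.

Lemma polyactM_XsubC p d v :
  polyact (p * ('X - d%:P)) v = polyact p (T v - d *: v).
Proof.
have iterB i : iter i T (T v - d *: v) = iter i.+1 T v - d *: iter i T v.
  by elim: i => //= i ->; rewrite linearB linearZ.
rewrite (@polyact_wide (size p).+1); last first.
  by rewrite (leq_trans (size_polyMleq _ _)) // size_XsubC addn2.
rewrite /polyact; under [RHS]eq_bigr do rewrite iterB scalerBr scalerA.
rewrite big_split /=.
under eq_bigr do rewrite mulrBr coefB coefMX coefMC scalerBl.
rewrite big_split /= big_ord_recl /= scale0r add0r; congr (_ + _).
rewrite big_ord_recr /= nth_default // mul0r scale0r oppr0 addr0.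
by [].
Qed.

Lemma polyact_geigen p c d N v :
  iter N (fun u => T u - d *: u) v = 0 -> ('X - d%:P) ^+ N %| p - c%:P ->
  polyact p v = c *: v.
Proof.
move=> vN /dvdpP[q pE]; rewrite -[p](subrK c%:P) polyactD polyactC pE.
suff -> : polyact (q * ('X - d%:P) ^+ N) v = 0 by rewrite add0r.
elim: N v vN {pE} => [|N IHN] v vN; first by rewrite [v]vN polyact0r.
by rewrite exprSr mulrA polyactM_XsubC IHN // -iterSr.
Qed.

Lemma polyact_sumr p (I : finType) (v : I -> V) :
  polyact p (\sum_i v i) = \sum_i polyact p (v i).
Proof.
rewrite /polyact [RHS]exchange_big; apply: eq_bigr => i _ /=.
have -> : iter i T (\sum_j v j) = \sum_j iter i T (v j).
  by elim: (i : nat) => //= j ->; rewrite linear_sum.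
by rewrite scaler_sumr.
Qed.

Lemma polyact_closed (P : {pred V}) p v :
  submod_closed P -> {homo T : u / u \in P} -> v \in P -> polyact p v \in P.
Proof.
move=> [P0 Plin] TP Pv; rewrite /polyact.
apply: (big_ind (fun u => u \in P)) => // [u w Pu Pw|i _].
  by rewrite -[u]scale1r Plin.
rewrite -[_ *: _]addr0 Plin //; elim: (i : nat) => //= j; exact: TP.
Qed.

End PolyAct.

(** Left multiplication by [P] and right multiplication by [Q] commute, so the iterate is a
    combination of the [P ^+ i *m Z *m Q ^+ j] with [i + j = k]; the induction avoids binomial
    coefficients. *)
Lemma iter_twisted_commutator0 (R : pzRingType) n (P Q : 'M[R]_n) k (Z : 'M[R]_n) :
  (forall i j, (i + j)%N = k -> P ^+ i *m Z *m Q ^+ j = 0) ->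
  iter k (fun Z => P *m Z - Z *m Q) Z = 0.
Proof.
elim: k Z => [|k IHk] Z PZQ; first by have := PZQ 0%N 0%N erefl; rewrite mulmx1 mul1mx.
rewrite iterSr; apply: IHk => i j ij.
rewrite mulmxBr mulmxBl !mulmxA.
have -> : P ^+ i *m P = P ^+ i.+1 by rewrite exprSr.
have -> : P ^+ i *m Z *m Q *m Q ^+ j = P ^+ i *m Z *m Q ^+ j.+1 by rewrite -mulmxA exprS.
by rewrite !PZQ ?subr0 // ?addnS ?addSn ij.
Qed.

(** Perfectness of [g]: a subspace containing all products is an ideal, and it is non-zero because
    some product is. *)
Lemma simple_lie_nonzero_product (F : fieldType) (g : leibnizType F) (I : {pred g}) :
  simple_lie g -> submod_closed I -> (forall x y, x ** y \in I) -> forall x, x \in I.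
Proof.
move=> [_ [x [y xy]] simp] Isub Iprod.
have /simp[I0|IT] : is_ideal I by split.
  by have := Iprod x y; rewrite I0 => /eqP.
by move=> z; rewrite IT.
Qed.

(** Integer coefficients let the same combination be read in [K] for the eigenvalues and in [rat]
    for their images. *)
Lemma sum_relation_difference (R : pzRingType) k (f : 'I_k -> R) (j l j' l' : 'I_k) :
  \sum_i ((i == j)%:R - (i == l)%:R - (i == j')%:R + (i == l')%:R : int)%:~R * f i
  = f j - f l - f j' + f l'.
Proof.
have sum1 h : \sum_i ((i == h)%:R : int)%:~R * f i = f h.
  rewrite (bigD1 h) //= eqxx mul1r big1 ?addr0 // => i /negPf->; exact: mul0r.
rewrite -!sum1 -!sumrB -big_split /=; apply: eq_bigr => i _.
by rewrite intrD !intrB mulrDl !mulrBl.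
Qed.

(* Hermite interpolation at the differences [a j - a l] turns the commutator with
   [\sum_j c j *: E j] into a polynomial in [T]: this is the step of Cartan's
   criterion showing that the bracket with a "replica" of [A] preserves every
   [ad A]-stable subspace. *)
Lemma replica_stable (K : fieldType) n (A : 'M[K]_n) k (a c : 'I_k -> K)
    (E : 'I_k -> 'M[K]_n) N (P : {pred 'M[K]_n}) :
    \sum_i E i = 1%:M ->
    (forall i, (A - (a i)%:M) ^+ N *m E i = 0) ->
    (forall i, E i *m (A - (a i)%:M) ^+ N = 0) ->
    (forall j l j' l', a j - a l = a j' - a l' -> c j - c l = c j' - c l') ->
    submod_closed P -> {homo (fun Z => A *m Z - Z *m A) : Z / Z \in P} ->
  let y := \sum_i c i *: E i in
  {homo (fun Z => y *m Z - Z *m y) : Z / Z \in P}.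
Proof.
move=> sumE nilE nilE' c_ext Psub PT y Z PZ.
pose T : {linear 'M[K]_n -> 'M[K]_n} := mulmx A \- mulmxr A.
pose ds := [seq a jl.1 - a jl.2 | jl : 'I_k * 'I_k].
pose s := undup ds.
(* By the hypothesis on [c] the value does not depend on the pair representing [d]; the default 0 is
   never met on [ds]. *)
pose dc d := if [pick jl : 'I_k * 'I_k | a jl.1 - a jl.2 == d] is Some jl
             then c jl.1 - c jl.2 else 0.
(* The exponent is [N + N] because of two exponents with this sum one is at least [N], so that
   [nilE] or [nilE'] applies. *)
have [p pP] := hermite_interpolation dc (N + N) (undup_uniq ds).
suff <- : polyact T p Z = y *m Z - Z *m y by apply: polyact_closed.
(* Each block [E j *m Z *m E l] is killed by a power of [T - (a j - a l)], so [p(T)] multiplies it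
   by [c j - c l]. *)
have ZE : Z = \sum_jl E jl.1 *m Z *m E jl.2.
  rewrite -(pair_bigA _ (fun j l => E j *m Z *m E l)) /=.
  under eq_bigr do rewrite -mulmx_sumr sumE mulmx1.
  by rewrite -mulmx_suml sumE mul1mx.
rewrite {1}ZE polyact_sumr.
have polyE jl : polyact T p (E jl.1 *m Z *m E jl.2)
    = (c jl.1 - c jl.2) *: (E jl.1 *m Z *m E jl.2).
  set d := a jl.1 - a jl.2.
  apply: (@polyact_geigen _ _ _ _ _ d (N + N)); last first.
    have : d \in s by rewrite mem_undup; apply/imageP; exists jl.
    move/pP; rewrite /dc; case: pickP => [jl' /eqP E'|/(_ jl)]; last by rewrite eqxx.
    by rewrite (c_ext _ _ _ _ E').
  rewrite -[RHS](@iter_twisted_commutator0 _ _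
    (A - (a jl.1)%:M) (A - (a jl.2)%:M) (N + N) (E jl.1 *m Z *m E jl.2)).
    apply: eq_iter => u; rewrite /= mulmxBl mulmxBr mul_scalar_mx mul_mx_scalar.
    by rewrite /d scalerBl !opprB addrACA [RHS]addrACA; congr (_ + _); rewrite addrC.
  move=> h h' hh'; have [hN|hN] := leqP N h.
    by rewrite -(subnK hN) exprD !mulmxA -[_ *m E jl.1]mulmxA nilE mulmx0 !mul0mx.
  have h'N : (N <= h')%N by rewrite -(leq_add2l N) -hh' leq_add2r ltnW.
  by rewrite -(subnKC h'N) exprD -!mulmxA [E jl.2 *m _]mulmxA nilE' mul0mx !mulmx0.
under eq_bigr do rewrite polyE scalerBl.
rewrite sumrB; congr (_ - _).
  rewrite -(pair_bigA _ (fun j l => c j *: (E j *m Z *m E l))) /=.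
  under eq_bigr do rewrite -scaler_sumr -mulmx_sumr sumE mulmx1.
  by rewrite /y mulmx_suml; apply: eq_bigr => j _; rewrite scalemxAl.
rewrite -(pair_bigA _ (fun j l => c l *: (E j *m Z *m E l))) /= exchange_big /=.
rewrite /y mulmx_sumr; apply: eq_bigr => l _; rewrite -scaler_sumr -mulmx_suml.
by rewrite -mulmx_suml sumE mul1mx scalemxAr.
Qed.

(* Matrices act on row vectors from the right, which reverses products. *)
Definition anti_representation (F : fieldType) (g : leibnizType F) n
    (B : g -> 'M[F]_n) :=
  forall x y, B (x ** y) = B y *m B x - B x *m B y.

Lemma trace_form_nilpotent (F : fieldType) (g : leibnizType F) n
    (B : {linear g -> 'M[F]_n}) :
    [pchar F] =i pred0 -> simple_lie g -> anti_representation B ->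
    (forall u v, \tr (B u *m B v) = 0) ->
  forall x, exists k, B x ^+ k = 0.
Proof.
move=> F0 simple_g BM tr0 x.
have [K [i [s sE]]] := splitting_field (char_poly_monic (B x)).
pose A := map_mx i (B x).
have chiA : char_poly A = \prod_(z <- s) ('X - z%:P) by rewrite -map_char_poly.
have [k [a [E [N [sumE rkE comE nilE nilE']]]]] := spectral_idempotents chiA.
have K0 := map_pchar0 i F0.
suff a0 : forall j, a j = 0.
  exists N; apply: (@map_mx_inj _ _ i); rewrite raddf0.
  have -> : map_mx i (B x ^+ N) = A ^+ N.
    by elim: N {nilE nilE'} => [|h IHh]; rewrite ?expr0 ?map_mx1 // !exprS map_mxM IHh.
  rewrite -[LHS]mulmx1 -sumE mulmx_sumr big1 // => j _.
  by have := nilE j; rewrite a0 raddf0 subr0.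
apply: (orthogonal_relations_eq0 (w := fun j => \rank (E j)) K0) => [h|m m_rel].
  by have [] := rkE h.
(* [y] acts on the generalized eigenspace of [A] for [a j] as the rational scalar [m j]. *)
pose y := \sum_j (ratr (m j) : K) *: E j.
(* The orthogonal of the image of [g] is stable under [ad A], and contains this
   image by hypothesis. *)
pose P := [pred Z | `[< forall u, \tr (map_mx i (B u) *m Z) = 0 >]].
have BE u v : map_mx i (B (u ** v))
    = map_mx i (B v) *m map_mx i (B u) - map_mx i (B u) *m map_mx i (B v).
  by rewrite BM map_mxB !map_mxM.
have Py : {homo (fun Z => y *m Z - Z *m y) : Z / Z \in P}.
  apply: (replica_stable sumE nilE nilE') => [j l j' l' aE||Z].
  (* An equality between differences of eigenvalues is a rational relation, which [m_rel] carries
     over to [m]. *)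
  - have /m_rel : \sum_i ratr ((i == j)%:R - (i == l)%:R - (i == j')%:R
                              + (i == l')%:R : int)%:~R * a i = 0.
      under eq_bigr do rewrite ratr_int.
      by rewrite sum_relation_difference aE; ring.
    rewrite sum_relation_difference => mE0.
    have mE : m j + m l' = m j' + m l.
      by apply/eqP; rewrite -subr_eq0 -[X in _ == X]mE0; apply/eqP; ring.
    have : (ratr (m j + m l') : K) = ratr (m j' + m l) by rewrite mE.
    rewrite !(ratrD_pchar0 K0) => mE'; apply/eqP.
    by rewrite subr_eq addrAC eq_sym subr_eq eq_sym mE'.
  - split=> [|c Z Z' /asboolP PZ /asboolP PZ'].
      by apply/asboolP => u; rewrite mulmx0 mxtrace0.
    apply/asboolP => u; rewrite mulmxDr mxtraceD -scalemxAr mxtraceZ PZ PZ'.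
    by rewrite mulr0 addr0.
  - move=> /asboolP PZ; apply/asboolP => u.
    have := PZ (x ** u); rewrite BE !mulmxBl mulmxBr !raddfB /= !mulmxA => E0.
    rewrite -[RHS]E0; congr (_ - _).
    by rewrite mxtrace_mulC mulmxA.
(* By cyclicity, the trace of [B (u ** v)] against [y] is that of [B v] against a commutator of
   [B u] and [y], which lies in [P] up to sign; perfectness of [g] then gives all [v]. *)
have Iall : forall v, v \in [pred v | \tr (map_mx i (B v) *m y) == 0].
  apply: simple_lie_nonzero_product simple_g _ _ => [|u v].
    split=> [|c u v]; first by rewrite inE linear0 raddf0 mul0mx mxtrace0.
    rewrite !inE => /eqP u0 /eqP v0.
    rewrite linearP map_mxD map_mxZ mulmxDl -scalemxAl mxtraceD mxtraceZ u0 v0.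
    by rewrite mulr0 addr0.
  have /Py/asboolP/(_ v) : map_mx i (B u) \in P.
    by apply/asboolP => w; rewrite -map_mxM trace_map_mx tr0 raddf0.
  rewrite inE BE mulmxBr mulmxBl !raddfB /= !mulmxA => E0.
  rewrite -oppr_eq0 opprB -[X in _ == X]E0; apply/eqP; congr (_ - _).
  by rewrite [RHS]mxtrace_mulC mulmxA.
(* [\tr (A *m E j)] is [a j *+ \rank (E j)], because [(A - (a j)%:M) *m E j] is nilpotent. *)
have := Iall x; rewrite inE => /eqP; rewrite /y mulmx_sumr raddf_sum /= => E0.
rewrite -[RHS]E0; apply: eq_bigr => j _.
rewrite -scalemxAr mxtraceZ; congr (_ * _).
have [_ idE] := rkE j.
rewrite -[a j *+ _]mulr_natr -(mxtrace_idem idE) -mxtraceZ.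
apply/esym/eqP; rewrite -subr_eq0 -raddfB /= -mul_scalar_mx -mulmxBl; apply/eqP.
(* [N.+1] leaves a factor [E j] even if [N = 0]. *)
apply: (@mxtrace_nilpotent _ _ _ N.+1).
rewrite -[_ *m _]/(_ * _) exprMn_comm.
  by rewrite exprS [E j ^+ _]exprS mulrA -[_ * E j]mulrA [_ ^+ N * E j]nilE mulr0 mul0r.
apply/comm_mx_sym/comm_mxB; last exact: comm_mx_scalar.
exact/comm_mx_sym.
Qed.

(** * Engel's theorem in a simple Lie algebra *)

#[short(type="fdLeibnizType")]
HB.structure Definition FdLeibniz (F : fieldType) :=
  {L of LeftLeibniz F L & Vector F L}.

Lemma lie_anticomm (F : fieldType) (g : leibnizType F) (x y : g) :
  (forall x : g, x ** x = 0) -> x ** y = - (y ** x).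
Proof.
move=> sq0; apply/eqP; rewrite -addr_eq0; apply/eqP; have := sq0 (x + y).
by rewrite lmulDl !lmulDr !sq0 addr0 add0r.
Qed.

Section Engel.
Variables (F : fieldType) (g : fdLeibnizType F).
Hypothesis sq0 : forall x : g, x ** x = 0.
Hypothesis ad_nil : forall x y : g, exists k, iter k (lmul x) y = 0.

(** A vector sent into [W] by [K] stays so under powers of [x], since [K ** x] lies in [K]; the last
    iterate outside [W] is sent into [W] by [x] too. *)
Lemma engel_extension (H K : {vspace g}) (x : g) (W V : {vspace g}) :
    (forall h, h \in H -> exists2 k, k \in K & exists a, h = k + a *: x) ->
    (forall k, k \in K -> k ** x \in K) ->
    (forall w, w \in W -> x ** w \in W) -> (forall v, v \in V -> x ** v \in V) ->
    (exists v, [/\ v \in V, v \notin W & forall k, k \in K -> k ** v \in W]) ->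
  exists v, [/\ v \in V, v \notin W & forall h, h \in H -> h ** v \in W].
Proof.
move=> HE Kx xW xV [v [Vv Wv Kv]].
have iterV j : iter j (lmul x) v \in V by elim: j => //= j; exact: xV.
have iterK j k : k \in K -> k ** iter j (lmul x) v \in W.
  elim: j k => [|j IHj] k Kk; first exact: Kv.
  by rewrite /= lmul_leibniz rpredD ?IHj ?Kx // xW // IHj.
have [k0 k0P] := ad_nil x v.
have exW : exists k, iter k (lmul x) v \in W by exists k0; rewrite k0P mem0v.
case: (ex_minnP exW) => -[|k] Wk kmin; first by rewrite Wk in Wv.
exists (iter k (lmul x) v); split=> //.
  by apply/negP => /kmin; rewrite ltnn.
by move=> h /HE[h' Kh' [a ->]]; rewrite lmulDl lmulZl rpredD ?iterK // memvZ.
Qed.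

(** The pair [W <= V] stands for the quotient [V / W]. The induction on [\dim H] needs this
    generality: a maximal proper subalgebra [K] acts on [H] modulo [K], which yields an [x]
    normalizing [K]. *)
Lemma engel (H W V : {vspace g}) :
    {in H &, forall x y, x ** y \in H} -> (W <= V)%VS -> ~~ (V <= W)%VS ->
    (forall h w, h \in H -> w \in W -> h ** w \in W) ->
    (forall h v, h \in H -> v \in V -> h ** v \in V) ->
  exists v, [/\ v \in V, v \notin W & forall h, h \in H -> h ** v \in W].
Proof.
have [d] := ubnP (\dim H); elim: d H W V => // d IHd H W V Hd HH WV VW HW HV.
have [H0|H0] := eqVneq H 0%VS.
  have /subvPn[v Vv Wv] := VW; exists v; split=> // h.
  by rewrite H0 memv0 => /eqP->; rewrite lmul0l mem0v.
pose P k := `[< exists K : {vspace g},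
  [/\ (K <= H)%VS, K != H, {in K &, forall x y, x ** y \in K} & \dim K = k] >].
have exP : exists k, P k.
  exists 0%N; apply/asboolP; exists 0%VS; split; rewrite ?sub0v ?dimv0 1?eq_sym //.
  by move=> x y; rewrite !memv0 => /eqP-> _; rewrite lmul0l.
have ubP k : P k -> (k <= \dim H)%N.
  by move=> /asboolP[K [KH _ _ <-]]; exact: dimvS.
case: (ex_maxnP exP ubP) => k /asboolP[K [KH KneH KK Kk]] kmax.
have HK : ~~ (H <= K)%VS by apply: contra KneH => HK; rewrite eqEsubv KH.
have Kd : (\dim K < d)%N.
  rewrite -ltnS; apply: leq_ltn_trans Hd.
  by rewrite ltn_neqAle (dimv_leqif_eq KH) KneH dimvS.
have [x [Hx Kx xK]] :
    exists x, [/\ x \in H, x \notin K & forall h, h \in K -> h ** x \in K].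
  apply: IHd => // h v Kh Hv.
  by apply: HH => //; exact: (subvP KH).
have xx a : (a *: x) ** x = 0 by rewrite lmulZl sq0 scaler0.
(* [K + <[x]>] is a subalgebra, as [x] normalizes [K] and [x ** x = 0]; maximality of [\dim K] makes
   it all of [H]. *)
have HKx : H = (K + <[x]>)%VS.
  apply: contraNeq Kx => neH; have := kmax (\dim (K + <[x]>)%VS).
  have -> : P (\dim (K + <[x]>)%VS).
    apply/asboolP; exists (K + <[x]>)%VS; split=> //; first by rewrite subv_add KH -memvE.
      by rewrite eq_sym.
    move=> z z' /memv_addP[u Ku [_ /vlineP[a ->] ->]].
    move=> /memv_addP[w Kw [_ /vlineP[b ->] ->]].
    apply: (subvP (addvSl K <[x]>%VS)).
    rewrite lmulDl !lmulDr !lmulZr xx scaler0 addr0 lmulZl (lie_anticomm x w sq0).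
    by rewrite !rpredD ?memvZ ?rpredN ?xK // KK.
  rewrite -Kk (geq_leqif (dimv_leqif_sup (addvSl K <[x]>%VS))) => /(_ isT).
  by rewrite subv_add subvv -memvE.
apply: (@engel_extension H K x) => [h||||] //.
- by rewrite HKx => /memv_addP[u Ku [_ /vlineP[a ->] ->]]; exists u => //; exists a.
- by move=> w; apply: HW.
- by move=> v; apply: HV.
- apply: IHd => // [u w Ku Kw|u v Ku Kv]; [apply: HW|apply: HV] => //; exact: (subvP KH).
Qed.

(** Engel's theorem for the adjoint action gives a non-zero [v] killed by all of [g]. Its line is an
    ideal, so simplicity would make [g] a line, hence abelian. *)
Lemma ad_nilpotent_not_simple : ~ simple_lie g.
Proof.
move=> [_ [x [y xy]] simp].
have [v [_ v0 gv]] : exists v : g,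
    [/\ v \in fullv, v \notin 0%VS & forall h, h \in fullv -> h ** v \in 0%VS].
  apply: engel => [u w _ _|||h w _|h w _ _]; rewrite ?memvf ?sub0v //.
    apply/negP => /subvP f0; apply: xy.
    by have := f0 x (memvf x); rewrite memv0 => /eqP->; rewrite lmul0l.
  by rewrite !memv0 => /eqP->; rewrite lmul0r.
have vI : is_ideal [pred u | u \in <[v]>%VS].
  split.
    split=> [|a u w]; rewrite !inE; first exact: mem0v.
    by move=> vu vw; rewrite memvD ?memvZ.
  move=> u w; rewrite !inE => /vlineP[a ->].
  rewrite (lie_anticomm (a *: v) u sq0).
  have -> : u ** (a *: v) = 0.
    by apply/eqP; rewrite -memv0 lmulZr memvZ // gv ?memvf.
  by rewrite oppr0 mem0v.
have [I0|IT] := simp _ vI.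
  by have := I0 v; rewrite memv_line inE -memv0 (negPf v0).
have /vlineP[a xE] : x \in <[v]>%VS by rewrite IT.
have /vlineP[b yE] : y \in <[v]>%VS by rewrite IT.
by apply: xy; rewrite xE yE lmulZl lmulZr sq0 !scaler0.
Qed.

End Engel.

(** * Whitehead's first lemma and Weyl's theorem *)

Section Whitehead.
Variables (F : fieldType) (F0 : [pchar F] =i pred0).
Variables (g : fdLeibnizType F) (simple_g : simple_lie g) (n : nat).

Let sq0 (x : g) : x ** x = 0.
Proof. by have [[]] := simple_g. Qed.

Section TraceForm.
Variables (B : {linear g -> 'M[F]_n}) (BM : anti_representation B).
Hypothesis B_neq0 : exists x, B x <> 0.

Lemma trace_form_invariant x y z :
  \tr (B (x ** y) *m B z) + \tr (B y *m B (x ** z)) = 0.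
Proof.
rewrite !BM mulmxBl mulmxBr !raddfB /= !mulmxA.
rewrite -[B x *m B y *m _]mulmxA [\tr (B x *m (B y *m B z))]mxtrace_mulC.
by rewrite -[X in X + _]opprB addNr.
Qed.

Lemma simple_faithful x : B x = 0 -> x = 0.
Proof.
move=> Bx0; have [_ _ simp] := simple_g.
have kI : is_ideal [pred x | B x == 0].
  split=> [|u v].
    split=> [|a u v]; first by rewrite inE linear0.
    by rewrite !inE linearP => /eqP-> /eqP->; rewrite scaler0 addr0.
  by rewrite !inE !BM => /eqP->; rewrite !mulmx0 !mul0mx subrr.
have [k0|kT] := simp _ kI.
  by have := k0 x; rewrite !inE Bx0 eqxx => /esym/eqP.
by have [y []] := B_neq0; have := kT y; rewrite inE => /eqP.
Qed.

(** The radical of the form is an ideal. Were it all of [g], every [B u] would be nilpotent, hence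
    also every adjoint map as [B] is faithful, against Engel's theorem. *)
Lemma trace_form_nondegenerate x : (forall y, \tr (B x *m B y) = 0) -> x = 0.
Proof.
move=> xR; have [_ _ simp] := simple_g.
have RI : is_ideal [pred x | `[< forall y, \tr (B x *m B y) = 0 >]].
  split=> [|u v].
    split=> [|a u v]; first by apply/asboolP => y; rewrite linear0 mul0mx mxtrace0.
    move=> /asboolP uR /asboolP vR; apply/asboolP => y.
    by rewrite linearP mulmxDl mxtraceD -scalemxAl mxtraceZ uR vR mulr0 addr0.
  move=> /asboolP vR.
  have uvR y : \tr (B (u ** v) *m B y) = 0.
    by have := trace_form_invariant u v y; rewrite vR addr0.
  split; apply/asboolP => y //.
  by rewrite lie_anticomm // linearN mulNmx raddfN /= uvR oppr0.
have [R0|RT] := simp _ RI.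
  have := R0 x; rewrite !inE => xE; apply/eqP; rewrite -xE.
  exact/asboolP.
case: (@ad_nilpotent_not_simple _ g) => // u v.
have [|k uk] := trace_form_nilpotent F0 simple_g BM _ u.
  by move=> w z; have := RT w; rewrite inE => /asboolP.
(* [B] turns the adjoint map of [u] into the commutator with [- B u]; of two exponents with sum
   [k + k], one is at least [k]. *)
exists (k + k)%N; apply: simple_faithful.
have -> : B (iter (k + k) (lmul u) v)
    = iter (k + k) (fun Z => - B u *m Z - Z *m - B u) (B v).
  elim: (k + k)%N => //= j <-.
  by rewrite BM mulmxN opprK mulNmx addrC.
apply: iter_twisted_commutator0 => i j ij.
have uk' : (- B u) ^+ k = 0 by rewrite exprNn uk mulr0.
have [ki|ki] := leqP k i; first by rewrite -(subnK ki) exprD uk' mulr0 !mul0mx.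
have kj : (k <= j)%N by rewrite -(leq_add2l k) -ij leq_add2r ltnW.
by rewrite -(subnK kj) exprD uk' mulr0 mulmx0.
Qed.

(* [\sum_(i, j) S i j *: (e i \otimes e j)] is the invariant tensor dual to the
   trace form of [B]. *)
Lemma invariant_tensor :
  exists (d : nat) (e : 'I_d -> g) (S : 'M[F]_d),
    [/\ (0 < d)%N,
        \sum_i \sum_j S i j * \tr (B (e i) *m B (e j)) = d%:R &
        forall (W : lmodType F) (Phi : g -> g -> W) x,
          bilinear_for *:%R *:%R Phi ->
          \sum_i \sum_j S i j *: (Phi (x ** e i) (e j) + Phi (e i) (x ** e j)) = 0].
Proof.
pose d := \dim {:g}; pose e (i : 'I_d) := (vbasis {:g})`_i.
pose T := \matrix_(i, j) \tr (B (e i) *m B (e j)).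
have eE u : u = \sum_i coord (vbasis {:g}) i u *: e i.
  exact: (coord_vbasis (memvf u)).
have tr_e0 v : (forall j, \tr (B v *m B (e j)) = 0) -> v = 0.
  move=> v0; apply: trace_form_nondegenerate => y.
  rewrite (eE y) [B (\sum_i _)]linear_sum mulmx_sumr raddf_sum /=.
  by apply: big1 => j _; rewrite linearZ -scalemxAr mxtraceZ /= v0 mulr0.
have uT : T \in unitmx.
  rewrite -row_free_unit -kermx_eq0; apply/eqP/row_matrixP => h; rewrite row0.
  set u := row h _.
  have uT0 : u *m T = 0 by rewrite -row_mul mulmx_ker row0.
  have u0 : \sum_i u 0 i *: e i = 0.
    apply: tr_e0 => j.
    have /matrixP/(_ 0 j) := uT0; rewrite !mxE => E0; rewrite -[RHS]E0.
    rewrite linear_sum mulmx_suml raddf_sum; apply: eq_bigr => i _ /=.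
    by rewrite linearZ -scalemxAl mxtraceZ [T i j]mxE.
  have /freeP fr := basis_free (vbasisP {:g}).
  by apply/rowP => i; rewrite (fr _ u0) mxE.
exists d, e, (invmx T); split.
- have [_ [x [y xy]] _] := simple_g; rewrite lt0n dimv_eq0.
  apply/negP => /eqP f0; apply: xy.
  by have := memvf x; rewrite f0 memv0 => /eqP->; rewrite lmul0l.
- rewrite -[RHS]mxtrace1 -(mulVmx uT) /mxtrace; apply: eq_bigr => i _.
  rewrite mxE; apply: eq_bigr => j _; congr (_ * _).
  by rewrite mxE mxtrace_mulC.
move=> W Phi x Phi_bil.
pose A := \matrix_(i, k) coord (vbasis {:g}) k (x ** e i).
have AE i : x ** e i = \sum_k A i k *: e k.
  by rewrite [LHS]eE; apply: eq_bigr => k _; rewrite mxE.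
have PhiDl u v w : Phi (u + v) w = Phi u w + Phi v w.
  by have := Phi_bil.1 w 1 u v; rewrite /= !scale1r.
have PhiDr u v w : Phi w (u + v) = Phi w u + Phi w v.
  by have := Phi_bil.2 w 1 u v; rewrite /= !scale1r.
have Phi0l w : Phi 0 w = 0.
  by apply: (@addrI _ (Phi 0 w)); rewrite -PhiDl !addr0.
have Phi0r w : Phi w 0 = 0.
  by apply: (@addrI _ (Phi w 0)); rewrite -PhiDr !addr0.
have PhiZl a u w : Phi (a *: u) w = a *: Phi u w.
  by have := Phi_bil.1 w a u 0; rewrite /= Phi0l !addr0.
have PhiZr a u w : Phi w (a *: u) = a *: Phi w u.
  by have := Phi_bil.2 w a u 0; rewrite /= Phi0r !addr0.
have Phil i w : Phi (x ** e i) w = \sum_k A i k *: Phi (e k) w.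
  rewrite AE (big_morph (Phi^~ w) (fun u v => PhiDl u v w) (Phi0l w)).
  by apply: eq_bigr => k _; rewrite PhiZl.
have Phir w j : Phi w (x ** e j) = \sum_k A j k *: Phi w (e k).
  rewrite AE (big_morph (Phi w) (fun u v => PhiDr u v w) (Phi0r w)).
  by apply: eq_bigr => k _; rewrite PhiZr.
(* Invariance of the form, read on its Gram matrix; multiplying by the inverse on both sides
   transfers it to the dual tensor. *)
have AT : A *m T + T *m A^T = 0.
  apply/matrixP => i j; rewrite !mxE -[RHS](trace_form_invariant x (e i) (e j)).
  congr (_ + _).
    rewrite AE [B (\sum_k _)]linear_sum mulmx_suml raddf_sum.
    by apply: eq_bigr => k _ /=; rewrite linearZ -scalemxAl mxtraceZ [T _ _]mxE.
  rewrite AE [B (\sum_k _)]linear_sum mulmx_sumr raddf_sum.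
  apply: eq_bigr => k _ /=; rewrite linearZ -scalemxAr mxtraceZ [T _ _]mxE.
  by rewrite [A^T _ _]mxE mulrC.
set S := invmx T.
have SA : S *m A + A^T *m S = 0.
  have : S *m (A *m T + T *m A^T) *m S = 0 by rewrite AT mulmx0 mul0mx.
  rewrite mulmxDr mulmxDl !mulmxA -[S *m A *m T *m S]mulmxA (mulmxV uT) mulmx1.
  by rewrite (mulVmx uT) mul1mx.
have sumE : \sum_i \sum_j (S *m A + A^T *m S) i j *: Phi (e i) (e j) = 0.
  by rewrite SA; apply: big1 => i _; apply: big1 => j _; rewrite mxE scale0r.
rewrite -[RHS]sumE.
transitivity (\sum_i \sum_j S i j *: Phi (x ** e i) (e j)
              + \sum_i \sum_j S i j *: Phi (e i) (x ** e j)).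
  rewrite -big_split; apply: eq_bigr => i _; rewrite -big_split.
  by apply: eq_bigr => j _; rewrite scalerDr.
transitivity (\sum_i \sum_j (A^T *m S) i j *: Phi (e i) (e j)
              + \sum_i \sum_j (S *m A) i j *: Phi (e i) (e j)); last first.
  rewrite -big_split; apply: eq_bigr => i _; rewrite -big_split.
  by apply: eq_bigr => j _; rewrite [in RHS]mxE scalerDl addrC.
congr (_ + _).
  under eq_bigr do under eq_bigr do rewrite Phil scaler_sumr.
  under [RHS]eq_bigr do under eq_bigr do rewrite mxE scaler_suml.
  under [RHS]eq_bigr do rewrite exchange_big.
  rewrite [RHS]exchange_big; apply: eq_bigr => i _ /=.
  rewrite exchange_big; apply: eq_bigr => k _ /=; apply: eq_bigr => j _.
  by rewrite scalerA [A^T k i]mxE mulrC.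
apply: eq_bigr => i _.
under eq_bigr do rewrite Phir scaler_sumr.
under [RHS]eq_bigr do rewrite mxE scaler_suml.
rewrite [RHS]exchange_big; apply: eq_bigr => k _; apply: eq_bigr => j _ /=.
by rewrite scalerA.
Qed.

End TraceForm.

Lemma whitehead (B : {linear g -> 'M[F]_n}) (f : {linear g -> 'rV[F]_n}) :
    anti_representation B ->
    (forall x y, f (x ** y) = f y *m B x - f x *m B y) ->
  exists v, forall x, f x = v *m B x.
Proof.
move=> BM fM.
(* Induction on the rank of an equivariant projector [P]: its Fitting part [E] for
   the Casimir element [C] is nonzero, and [C] inverts the cocycle on [E]. *)
suff projected r (P : 'M[F]_n) : (\rank P < r)%N -> P *m P = P ->
    (forall x, comm_mx P (B x)) -> exists v, forall x, f x *m P = v *m B x.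
  have [||x|v vP] := projected n.+1 1%:M; rewrite ?ltnS ?rank_leq_row ?mulmx1 //.
    exact/comm_mx_sym/comm_mx1.
  by exists v => x; rewrite -vP mulmx1.
elim: r P => // r IHr P; rewrite ltnS => Pr PP PB.
pose B' : {linear g -> 'M[F]_n} := mulmxr P \o B.
pose f' : {linear g -> 'rV[F]_n} := mulmxr P \o f.
have PBP x : P *m B x *m P = B x *m P by rewrite PB -mulmxA PP.
have B'M : anti_representation B'.
  move=> x y; rewrite /= BM mulmxBl -!mulmxA.
  by rewrite [P *m (_ *m P)]mulmxA PBP [P *m (_ *m P)]mulmxA PBP.
have f'M x y : f' (x ** y) = f' y *m B' x - f' x *m B' y.
  by rewrite /= fM mulmxBl -!mulmxA [P *m (_ *m P)]mulmxA PBP [P *m (_ *m P)]mulmxA PBP.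
have [B'0|B'neq0] := pselect (forall x, B' x = 0).
  exists 0 => x; rewrite mul0mx; apply/eqP.
  have := @simple_lie_nonzero_product _ _ [pred x | f' x == 0] simple_g.
  apply=> [|u v]; last by rewrite inE f'M !B'0 !mulmx0 subrr.
  split=> [|a u v]; first by rewrite inE linear0.
  by rewrite !inE linearP => /eqP-> /eqP->; rewrite scaler0 addr0.
have {}B'neq0 : exists x, B' x <> 0 by apply/existsNP.
have [d [e [S [d0 trS inv]]]] := invariant_tensor B'M B'neq0.
pose C := \sum_i \sum_j S i j *: (B' (e i) *m B' (e j)).
pose w := \sum_i \sum_j S i j *: (f' (e i) *m B' (e j)).
(* The cocycle identity holds for [B'] as well as for [f']: [h := B'] makes [C] commute with the
   action, and [h := f'] makes [w] a primitive of [f'] up to the factor [C]. *)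
have casimir m (h : {linear g -> 'M[F]_(m, n)}) :
    (forall x y, h (x ** y) = h y *m B' x - h x *m B' y) -> forall x,
    (\sum_i \sum_j S i j *: (h (e i) *m B' (e j))) *m B' x = h x *m C.
  move=> hM x; apply/eqP; rewrite -subr_eq0.
  have bil : bilinear_for *:%R *:%R (fun u v => h u *m B' v).
    split=> u a v v'; first by rewrite linearP mulmxDl -scalemxAl.
    by rewrite linearP mulmxDr -scalemxAr.
  rewrite -[X in _ == X](inv _ _ x bil) mulmx_suml mulmx_sumr -sumrB.
  apply/eqP/eq_bigr => i _; rewrite mulmx_suml mulmx_sumr -sumrB.
  apply: eq_bigr => j _; rewrite -scalemxAl -scalemxAr -scalerBr; congr (_ *: _).
  by rewrite hM B'M mulmxBl mulmxBr !mulmxA [RHS]addrC addrA subrK.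
have CB' x : C *m B' x = B' x *m C by exact: casimir.
have wB' x : w *m B' x = f' x *m C by exact: casimir.
have B'P x : P *m B' x = B' x by rewrite /= mulmxA PBP.
have PB' x : B' x *m P = B' x by rewrite /= -mulmxA PP.
have PC : P *m C = C.
  rewrite mulmx_sumr; apply: eq_bigr => i _; rewrite mulmx_sumr.
  by apply: eq_bigr => j _; rewrite -scalemxAr mulmxA B'P.
have CP : C *m P = C.
  rewrite mulmx_suml; apply: eq_bigr => i _; rewrite mulmx_suml.
  by apply: eq_bigr => j _; rewrite -scalemxAl -mulmxA PB'.
have BC x : comm_mx (B x) C.
  by rewrite /comm_mx -[in LHS]PC mulmxA -[B x *m P]/(B' x) -CB' -[in RHS]CP -mulmxA PB.
have [D [E [DC EE [k nilC] commD commE]]] := fitting C.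
have PD : comm_mx P D by apply: commD; rewrite /comm_mx PC CP.
have PE : P *m E = E by rewrite -DC mulmxA PD -mulmxA PC.
have EP : E *m P = E by rewrite -DC -mulmxA CP.
have BE x : comm_mx (B x) E by exact: commE.
have CD : C *m D = E by rewrite -DC commD //; exact: comm_mx_refl.
have E_neq0 : E != 0.
  apply/eqP => E0; move: nilC; rewrite E0 subr0 mulmx1 => /mxtrace_nilpotent trC.
  move: d0; rewrite lt0n -((pcharf0P F).1 F0) -trS -[X in _ != X]trC => /eqP; apply.
  rewrite raddf_sum; apply: eq_bigr => i _; rewrite raddf_sum.
  by apply: eq_bigr => j _; rewrite /= mxtraceZ.
have [||x|v vP] := IHr (P - E).
- apply: leq_trans Pr; rewrite ltn_neqAle.
  have sub : (P - E <= P)%MS.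
    by rewrite -[X in (P - X <= _)%MS]EP -{1}[P]mul1mx -mulmxBl submxMl.
  rewrite mxrankS // andbT (mxrank_leqif_sup sub); apply: contra E_neq0.
  by case/submxP => X PX; rewrite -PE PX -mulmxA mulmxBl PE EE subrr mulmx0.
- by rewrite mulmxBl !mulmxBr PP PE EP EE subrr subr0.
- exact/comm_mx_sym/comm_mxB/BE/comm_mx_sym.
(* On the Fitting part, [f x *m E = f' x *m C *m D = w *m B' x *m D], and [D] commutes with the
   action; [v] accounts for [P - E]. *)
exists (w *m D *m P + v) => x.
rewrite -[P in LHS](subrK E) mulmxDr vP mulmxDl addrC; congr (_ + _).
rewrite -[LHS]/(f x *m E) -[in LHS]PE mulmxA -[f x *m P]/(f' x) -CD mulmxA -wB'.
by rewrite -mulmxA (commD (B' x) (esym (CB' x))) -!mulmxA PB.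
Qed.


End Whitehead.

Lemma mulmx_mxvec_inj (F : fieldType) m n p (A B : 'M[F]_(m * n, p)) :
  (forall h : 'M[F]_(m, n), mxvec h *m A = mxvec h *m B) -> A = B.
Proof.
by move=> AB; apply/row_matrixP => i; rewrite !rowE -[delta_mx 0 i]vec_mxK AB.
Qed.

(* Whitehead's lemma is applied to the module of the endomorphisms [h] with image
   in [W] and kernel containing [W], i.e. such that [h = (1 - p) h p] for a
   projector [p] onto [W], and to the cocycle [x |-> [p, B x]]. *)
Lemma weyl_mx (F : fieldType) (g : fdLeibnizType F) n (B : {linear g -> 'M[F]_n})
    (W : 'M[F]_n) :
    [pchar F] =i pred0 -> simple_lie g -> anti_representation B ->
    (forall x, W *m B x <= W)%MS ->
  exists Q : 'M[F]_n,
    [/\ (Q <= W)%MS, W *m Q = W & forall x, comm_mx Q (B x)].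
Proof.
move=> F0 simple_g BM WB.
have [p pW Wp] : exists2 p : 'M[F]_n, (p <= W)%MS & W *m p = W.
  by exists (pinvmx W *m W); rewrite ?submxMl // mulmxA mulmxKpV.
have Wid m (A : 'M[F]_(m, n)) : (A <= W)%MS -> A *m p = A.
  by case/submxP => D ->; rewrite -mulmxA Wp.
have pp : p *m p = p by exact: Wid.
have pB x : p *m B x *m p = p *m B x.
  by apply: Wid; apply: submx_trans (WB x); exact: submxMr.
have [pi piE] : exists pi : {linear 'M[F]_n -> 'M[F]_n},
    forall h, pi h = h *m p - p *m h *m p.
  exists (mulmx (1%:M - p) \o mulmxr p) => h.
  by rewrite /= mulmxBl mul1mx mulmxA.
have p_pi h : p *m pi h = 0 by rewrite piE mulmxBr !mulmxA pp subrr.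
have pi_p h : pi h *m p = pi h by rewrite piE mulmxBl -!mulmxA pp.
pose act x h := h *m B x - B x *m h.
have pi_act x h : pi (act x (pi h)) = act x (pi h).
  have -> : act x (pi h) = pi h *m B x - B x *m pi h by [].
  have pBpi : p *m B x *m pi h = 0 by rewrite -pB -mulmxA p_pi mulmx0.
  rewrite [LHS]piE mulmxBr !mulmxBl !mulmxA p_pi pBpi !mul0mx !subr0.
  have -> : pi h *m B x *m p = pi h *m B x.
    by rewrite -[pi h]pi_p -!mulmxA [p *m (_ *m _)]mulmxA pB.
  by rewrite -[B x *m _ *m p]mulmxA pi_p.
have pi_cocycle x : pi (act x p) = act x p.
  rewrite [LHS]piE /act mulmxBr !mulmxBl !mulmxA pp !pB.
  by rewrite -[B x *m p *m p]mulmxA pp subrr subr0.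
have actM x y h : act (x ** y) h = act x (act y h) - act y (act x h).
  rewrite /act BM !mulmxBl !mulmxBr !mulmxA.
  move: (h *m _ *m _) (h *m _ *m _) (_ *m h *m _) (_ *m h *m _) => a b c d.
  move: (_ *m _ *m h) (_ *m _ *m h) => e k.
  by apply/matrixP => i j; rewrite !mxE; ring.
(* Composing with [pi] extends the action by zero to all matrices, so that the module of
   endomorphisms needs no coordinates of its own. *)
have [sig sigE] : exists sig : {linear g -> 'M[F]_(n * n)},
    forall x h, mxvec h *m sig x = mxvec (act x (pi h)).
  exists (mulmx (lin_mx pi) \o ((lin_mulmxr \- lin_mulmx) \o B)) => x h.
  by rewrite /= mulmxA mul_vec_lin mulmxBr !mul_vec_lin -raddfB.
pose f : {linear g -> 'rV[F]_(n * n)} := mxvec \o ((mulmx p \- mulmxr p) \o B).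
have fE x : f x = mxvec (act x p) by [].
have sigM : anti_representation sig.
  move=> x y; apply: mulmx_mxvec_inj => h.
  by rewrite mulmxBr !mulmxA !sigE !pi_act actM raddfB.
have fM x y : f (x ** y) = f y *m sig x - f x *m sig y.
  by rewrite !fE !sigE !pi_cocycle actM raddfB.
have [v fv] := whitehead F0 simple_g sigM fM.
pose k := pi (vec_mx v).
have pk x : act x p = act x k.
  by apply: (can_inj mxvecK); rewrite -fE fv -[v]vec_mxK sigE.
(* [p] and [k] have the same commutators with every [B x]. The rows of [k] lie in [W] and
   [W *m k = 0], so [p - k] is still a projector onto [W]. *)
exists (p - k); split=> [||x].
- by rewrite addmx_sub ?eqmx_opp // -[k]pi_p; exact: mulmx_sub.
- by rewrite mulmxBr -[W in W *m k]Wp -mulmxA p_pi mulmx0 subr0.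
- have /eqP := pk x; rewrite /comm_mx /act mulmxBl mulmxBr -subr_eq0 => /eqP E.
  apply/eqP; rewrite -subr_eq0 -[X in _ == X]E; apply/eqP.
  move: (p *m _) (_ *m p) (k *m _) (_ *m k) => a b c d.
  by apply/matrixP => i j; rewrite !mxE; ring.
Qed.

(** * Finite dimension in coordinates *)

Lemma linear_lift (F : fieldType) (U V : lmodType F) (h : U -> V) :
  linear h -> exists h' : {linear U -> V}, h' =1 h.
Proof.
move=> lin; pose h' : {linear U -> V} := HB.pack h (GRing.isLinear.Build F U V _ h lin).
by exists h'.
Qed.

Lemma finite_dimensionalP (F : fieldType) (V : lmodType F) :
  finite_dimensional V ->
  exists n (v : {linear V -> 'rV[F]_n}) (w : {linear 'rV[F]_n -> V}),
    cancel v w /\ cancel w v.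
Proof.
move=> [n [[v vlin [w vK wK]]]]; have [v' v'E] := linear_lift vlin.
have wlin : linear w.
  by move=> a x y; apply: (can_inj vK); rewrite -[RHS]v'E linearP /= !v'E !wK.
have [w' w'E] := linear_lift wlin.
by exists n, v', w'; split=> x; rewrite v'E w'E.
Qed.

Lemma finite_dimensional_inj_rV (F : fieldType) (V : lmodType F) n
    (f : {linear V -> 'rV[F]_n}) :
  injective f -> finite_dimensional V.
Proof.
move=> inj_f; have [|A AP] := @submod_rowspace _ _ [pred u | `[< exists x, f x = u >]].
  split=> [|a _ _ /asboolP[x <-] /asboolP[y <-]]; apply/asboolP.
    by exists 0; rewrite linear0.
  by exists (a *: x + y); rewrite linearP.
have fA x : (f x <= row_base A)%MS by rewrite eq_row_base -AP; apply/asboolP; exists x.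
have /boolp.choice[h hP] : forall u : 'rV_(\rank A), exists x, f x = u *m row_base A.
  move=> u; have : (u *m row_base A <= A)%MS by rewrite -(eq_row_base A) submxMl.
  by rewrite -AP => /asboolP.
have [v vE] : exists v : {linear V -> 'rV_(\rank A)},
    forall x, v x = f x *m pinvmx (row_base A).
  by exists (mulmxr (pinvmx (row_base A)) \o f).
exists (\rank A); constructor; exists v; first exact: linearP.
exists h => x.
  by apply: inj_f; rewrite hP vE mulmxKpV.
by rewrite vE hP mulmxKp // row_base_free.
Qed.

Lemma finite_dimensional_inj (F : fieldType) (V W : lmodType F) (f : {linear V -> W}) :
  injective f -> finite_dimensional W -> finite_dimensional V.
Proof.
move=> inj_f /finite_dimensionalP[n [v [w [vK _]]]].
apply: (@finite_dimensional_inj_rV _ _ n (v \o f)); apply: inj_comp inj_f.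
exact: can_inj vK.
Qed.

(** The chosen preimages depend linearly on [y] only modulo the kernel of [f], which multiplication
    by [cokermx A] factors out. *)
Lemma finite_dimensional_surj (F : fieldType) (V W : lmodType F) (f : {linear V -> W}) :
  (forall y, exists x, f x = y) -> finite_dimensional V -> finite_dimensional W.
Proof.
move=> surj_f /finite_dimensionalP[n [v [w [vK wK]]]].
have [s fs] := boolp.choice surj_f.
have [|A AP] := @submod_rowspace _ _ [pred u | f (w u) == 0].
  split=> [|a u u']; first by rewrite inE !linear0.
  by rewrite !inE !linearP => /eqP-> /eqP->; rewrite scaler0 addr0.
have kerE x : (f x == 0) = (v x *m cokermx A == 0) by rewrite -submxE -AP inE vK.
have slin : linear (fun y => v (s y) *m cokermx A).
  move=> a y y'; have <- : v (a *: s y + s y') *m cokermx A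
      = a *: (v (s y) *m cokermx A) + v (s y') *m cokermx A.
    by rewrite linearP mulmxDl scalemxAl.
  apply/eqP; rewrite -subr_eq0 -mulmxBl -linearB -kerE linearB linearP /=.
  by rewrite !fs subrr.
have [h hE] := linear_lift slin.
apply: (@finite_dimensional_inj_rV _ _ n h) => y y' /eqP.
rewrite -subr_eq0 !hE -mulmxBl -linearB -kerE linearB /= !fs subr_eq0.
by move/eqP.
Qed.

Lemma finite_dimensional_pair (F : fieldType) (V W : lmodType F) :
  finite_dimensional V -> finite_dimensional W -> finite_dimensional (V * W)%type.
Proof.
move=> /finite_dimensionalP[m [v [v' [vK _]]]] /finite_dimensionalP[n [w [w' [wK _]]]].
have lin : linear (fun p : V * W => row_mx (v p.1) (w p.2)).
  by move=> a p q; rewrite !linearP scale_row_mx add_row_mx.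
have [h hE] := linear_lift lin.
apply: (@finite_dimensional_inj_rV _ _ _ h) => -[x y] [x' y'].
by rewrite !hE /= => /eq_row_mx[/(can_inj vK)-> /(can_inj wK)->].
Qed.

(** * Weyl's theorem for left modules *)

Section LeftModule.
Variables (F : fieldType) (g : leibnizType F) (M : left_module g).

Lemma left_actP x : linear (@left_act _ _ M x).
Proof. by move=> a u v; rewrite (left_act_bilinear M).2. Qed.

Lemma left_actPl a x y (m : M) : left_act (a *: x + y) m = a *: left_act x m + left_act y m.
Proof. exact: (left_act_bilinear M).1. Qed.

Lemma left_act0 x : left_act x (0 : M) = 0.
Proof. by have [h hE] := linear_lift (left_actP x); rewrite -hE linear0. Qed.

End LeftModule.

(** An equivariant projector is the convenient form of a complement: its kernel is the complementary
    submodule, and it can be evaluated on [left_act x m]. *)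
Theorem weyl (F : fieldType) (g : leibnizType F) (M : left_module g) (N : {pred M}) :
    [pchar F] =i pred0 -> finite_dimensional g -> simple_lie g ->
    finite_dimensional M -> left_submodule N ->
  exists pi : {linear M -> M},
    [/\ forall m, pi m \in N, {in N, forall m, pi m = m} &
        forall x m, pi (left_act x m) = left_act x (pi m)].
Proof.
move=> F0 [d [g_axiom]] simple_g /finite_dimensionalP[n [v [w [vK wK]]]] [[N0 Nlin] Nact].
pose g' : fdLeibnizType F :=
  HB.pack (LeftLeibniz.sort g) (Lmodule_hasFinDim.Build F g g_axiom).
have simple_g' : simple_lie g' by [].
have act_lift x : exists A : 'M[F]_n, forall u, u *m A = v (left_act x (w u)).
  have lin : linear (fun u => v (left_act x (w u))).
    by move=> a u u'; rewrite linearP left_actP linearP.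
  have [h hE] := linear_lift lin.
  by exists (lin1_mx h) => u; rewrite mul_rV_lin1 hE.
have [B BE] := boolp.choice act_lift.
have mx_inj (A A' : 'M[F]_n) : (forall u : 'rV_n, u *m A = u *m A') -> A = A'.
  by move=> AA'; apply/row_matrixP => i; rewrite !rowE.
have Blin : linear (B : g' -> _).
  move=> a x y; apply: mx_inj => u.
  by rewrite mulmxDr -scalemxAr !BE left_actPl linearP.
have [B' B'E] := linear_lift Blin.
have B'M : anti_representation B'.
  move=> x y; rewrite !B'E; apply: mx_inj => u.
  rewrite mulmxBr !mulmxA !BE !vK -raddfB; congr (v _); exact: left_act_lmul.
have [|W WP] := @submod_rowspace _ _ [pred u | w u \in N].
  by split=> [|a u u']; rewrite !inE ?linear0 // linearP => Nu Nu'; apply: Nlin.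
have vN m : (v m <= W)%MS = (m \in N) by rewrite -WP inE vK.
have [|Q [QW WQ QB]] := weyl_mx F0 simple_g' B'M (_ : forall x, W *m B' x <= W)%MS.
  move=> x; apply/row_subP => i; rewrite row_mul B'E BE vN Nact // -vN wK.
  exact: row_sub.
have pi_lin : linear (fun m => w (v m *m Q)).
  by move=> a m m'; rewrite linearP mulmxDl -scalemxAl linearP.
have [pi piE] := linear_lift pi_lin; exists pi; split=> [m|m Nm|x m]; rewrite !piE.
- by rewrite -vN wK mulmx_sub.
- by move: Nm; rewrite -vN => /submxP[D DE]; rewrite DE -mulmxA WQ -DE vK.
- have -> : v (left_act x m) = v m *m B' x by rewrite B'E BE vK.
  by rewrite -mulmxA -QB mulmxA B'E BE vK.
Qed.

(** * Complete reducibility from complements *)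

Lemma submod_dimension (F : fieldType) (V : lmodType F) :
  finite_dimensional V ->
  exists dm : {pred V} -> nat, forall N N' : {pred V},
    submod_closed N -> submod_closed N' -> {subset N <= N'} ->
    (dm N <= dm N')%N /\ ((dm N' <= dm N)%N -> {subset N' <= N}).
Proof.
move=> /finite_dimensionalP[n [v [w [vK wK]]]].
(* The matrix is chosen for all predicates at once, with 0 where [N] is not a subspace, so that [dm]
   is a total function. *)
have /boolp.choice[mx mxP] : forall N : {pred V}, exists A : 'M[F]_n,
    submod_closed N -> forall u, (w u \in N) = (u <= A)%MS.
  move=> N; have [[N0 Nlin]|notN] := pselect (submod_closed N); last by exists 0.
  have [|A AP] := @submod_rowspace _ _ [pred u | w u \in N].
    by split=> [|a u u']; rewrite !inE ?linear0 // linearP => Nu Nu'; apply: Nlin.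
  by exists A => _ u; rewrite -AP.
exists (fun N => \rank (mx N)) => N N' subN subN' NN'.
have mxS : (mx N <= mx N')%MS.
  by apply/row_subP => i; rewrite -mxP // NN' // mxP // row_sub.
split=> [|]; first exact: mxrankS.
rewrite (geq_leqif (mxrank_leqif_sup mxS)) => mxS' x.
by rewrite -[x]vK !mxP // => /submx_trans; apply.
Qed.

Section Decomposition.
Variables (F : fieldType) (V : lmodType F) (sub : {pred V} -> Prop).
Hypothesis V_fd : finite_dimensional V.
Hypothesis sub_submod : forall N, sub N -> submod_closed N.
Hypothesis subT : sub predT.
Hypothesis subI : forall N N', sub N -> sub N' -> sub [predI N & N'].
Hypothesis sub_compl : forall N, sub N -> exists2 N', sub N' & vs_direct_sum N N'.

Let sub0 N : sub N -> 0 \in N.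
Proof. by case/sub_submod. Qed.

Let subB N x y : sub N -> x \in N -> y \in N -> x - y \in N.
Proof. by move=> /sub_submod[_ lin] Nx Ny; rewrite -scaleN1r addrC lin. Qed.

Let subD N x y : sub N -> x \in N -> y \in N -> x + y \in N.
Proof. by move=> /sub_submod[_ lin] Nx Ny; rewrite -[x]scale1r lin. Qed.

(** A non-zero submodule [N0] of least dimension in [U] is irreducible. If [N1] is a complement of
    [N0] in [V], the modular law makes [U] the direct sum of [N0] and of [U] intersected with [N1],
    to which the induction applies. *)
Lemma finite_decomposition (U : {pred V}) : sub U ->
  exists k (N : 'I_k -> {pred V}),
    [/\ forall i, irreducible_sub sub (N i),
        forall x, x \in U ->
          exists2 f : 'I_k -> V, (forall i, f i \in N i) & x = \sum_i f i,
        forall i, {subset N i <= U} &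
        forall f : 'I_k -> V, (forall i, f i \in N i) -> \sum_i f i = 0 ->
          forall i, f i = 0].
Proof.
have [dm dmP] := submod_dimension V_fd.
have [r] := ubnP (dm U); elim: r U => // r IHr U dU subU.
have [U0|] := pselect (forall x, x \in U -> x = 0).
  exists 0%N, (fun=> (predT : {pred V})); split=> [[]|x Ux|[]|f _ _ []] //.
  by exists (fun=> 0) => [[]|] //; rewrite big_ord0 (U0 x).
move=> /existsNP[x0 /not_implyP[Ux0 x0_neq0]].
pose P k := `[< exists N,
  [/\ sub N, {subset N <= U}, exists2 x, x \in N & x <> 0 & dm N = k] >].
have exP : exists k, P k.
  by exists (dm U); apply/asboolP; exists U; split=> //; exists x0.
case: (ex_minnP exP) => k /asboolP[N0 [subN0 N0U [x1 N0x1 x1_neq0] N0k]] kmin.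
have irrN0 : irreducible_sub sub N0.
  split=> // [N00|N' subN' N'N0].
    by apply: x1_neq0; move: N0x1; rewrite N00 => /eqP.
  have [N'0|] := pselect (forall x, x \in N' -> x = 0).
    left=> x; rewrite inE; apply/idP/eqP => [/N'0 //|->]; exact: sub0.
  move=> /existsNP[x2 /not_implyP[N'x2 x2_neq0]]; right=> x.
  have dN' : (dm N0 <= dm N')%N.
    rewrite N0k; apply: kmin; apply/asboolP; exists N'; split=> //.
      by move=> y /N'N0/N0U.
    by exists x2.
  apply/idP/idP => [/N'N0 //|].
  by have [_ /(_ dN')] := dmP _ _ (sub_submod subN') (sub_submod subN0) N'N0; apply.
have [N1 subN1 [N01_sum N01_cap]] := sub_compl subN0.
have subU1 : sub [predI U & N1] by apply: subI.
have UU1 : {subset [predI U & N1] <= U} by move=> y /andP[].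
(* Otherwise [U], and with it [N0], would lie in [N1]. *)
have dU1 : (dm [predI U & N1] < r)%N.
  rewrite -ltnS; apply: leq_trans dU; rewrite ltnS ltnNge; apply/negP.
  have [_ /[apply]] := dmP _ _ (sub_submod subU1) (sub_submod subU) UU1.
  move=> /(_ x1 (N0U _ N0x1)) /andP[_ N1x1].
  by apply: x1_neq0; apply: N01_cap.
have [k' [N [irrN Nsum NU Nfree]]] := IHr _ dU1 subU1.
exists k'.+1, (fun i => if unlift ord0 i is Some j then N j else N0 : {pred V}); split.
- by move=> i; case: unliftP.
- move=> x Ux; have [a [b [N0a N1b xE]]] := N01_sum x.
  have Ub : b \in U by rewrite -[b](addrK a) addrC [b + a]addrC -xE addrC subB // N0U.
  have [|f fN bE] := Nsum b; first by rewrite inE Ub.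
  exists (fun i => if unlift ord0 i is Some j then f j else a) => [i|].
    by case: unliftP.
  rewrite big_ord_recl unlift_none xE bE; congr (_ + _).
  by apply: eq_bigr => i _; rewrite liftK.
- by move=> i; case: unliftP => [j _|_] x; [move/NU/UU1 | move/N0U].
- move=> f fN; rewrite big_ord_recl => sum0.
  have fN0 : f ord0 \in N0 by have := fN ord0; rewrite unlift_none.
  have fN' i : f (lift ord0 i) \in N i by have := fN (lift ord0 i); rewrite liftK.
  have f0 : f ord0 = 0.
    apply: N01_cap => //; rewrite -[f ord0]opprK -sub0r.
    apply: (subB subN1); first exact: sub0.
    have -> : - f ord0 = \sum_(i < k') f (lift ord0 i).
      by apply/eqP; rewrite eq_sym -addr_eq0 addrC sum0.
    apply: (big_ind (fun x => x \in N1)) => [|y z|i _]; [exact: sub0|exact: subD|].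
    by have /andP[] := NU i _ (fN' i).
  move: sum0; rewrite f0 add0r => sum0 i; case: (unliftP ord0 i) => [j ->|-> //].
  exact: (Nfree (fun i => f (lift ord0 i))).
Qed.

Lemma completely_reducible_of_complements : completely_reducible_for sub.
Proof.
have [k [N [irrN Nsum _ Nfree]]] := finite_decomposition subT.
exists 'I_k, N; split=> //; split=> [x|s f us sN sum0].
  have [f fN xE] := Nsum x isT; exists (index_enum 'I_k), f; split=> //.
  exact: index_enum_uniq.
have subN i : sub (N i) by case: (irrN i).
move=> i si; have := Nfree (fun i => if i \in s then f i else 0).
rewrite -big_mkcond -big_uniq // => /(_ _ sum0 i); rewrite si; apply.
by move=> j; case: ifP => [/sN//|_]; exact: sub0.
Qed.

End Decomposition.

Lemma completely_reducible_left_fd (F : fieldType) (g : leibnizType F)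
    (M : left_module g) :
    [pchar F] =i pred0 -> finite_dimensional g -> simple_lie g ->
    finite_dimensional M ->
  completely_reducible_left M.
Proof.
move=> F0 fd_g simple_g fd_M; apply: completely_reducible_of_complements => //.
- by move=> N [].
- move=> N N' [[N0 Nlin] Nact] [[N'0 N'lin] N'act]; split.
    split=> [|a u v]; first by rewrite inE N0.
    by move=> /andP[Nu N'u] /andP[Nv N'v]; rewrite inE [_ \in N]Nlin //= [_ \in N']N'lin.
  by move=> x m /andP[Nm N'm]; rewrite inE [_ \in N]Nact //= [_ \in N']N'act.
move=> N subN; have [pi [piN piE piM]] := weyl F0 fd_g simple_g fd_M subN.
pose K : {pred M} := [pred m | pi m == 0].
have KE m : (m \in K) = (pi m == 0) by [].
exists K.
  split; first split=> [|a u v]; first by rewrite KE linear0.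
    by rewrite !KE linearP => /eqP-> /eqP->; rewrite scaler0 addr0.
  by move=> x m; rewrite !KE piM => /eqP->; rewrite left_act0.
split=> [m|m Nm]; last by rewrite KE piE // => /eqP.
exists (pi m), (m - pi m); split=> //; last by rewrite addrC subrK.
by rewrite KE linearB /= (piE _ (piN m)) subrr.
Qed.

(** * Canonical Lie algebras and their lifts *)

Lemma inj_surj_bijective (A B : Type) (f : A -> B) :
  injective f -> (forall y, exists x, f x = y) -> bijective f.
Proof.
move=> inj_f /boolp.choice[h fh]; exists h => // x.
by apply: inj_f; rewrite fh.
Qed.

Lemma leibniz_isomorphic_sym (F : fieldType) (L L' : leibnizType F) :
  leibniz_isomorphic L L' -> leibniz_isomorphic L' L.
Proof.
move=> [f [[h fK hK] fM]].
have hlin : linear h by move=> a x y; apply: (can_inj fK); rewrite linearP !hK.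
have [h' h'E] := linear_lift hlin; exists h'; split.
  by exists f => x; rewrite h'E.
by move=> x y; rewrite !h'E; apply: (can_inj fK); rewrite fM !hK.
Qed.

Lemma simple_lie_isomorphic (F : fieldType) (L L' : leibnizType F) :
  leibniz_isomorphic L L' -> simple_lie L' -> simple_lie L.
Proof.
move=> [f [[h fK hK] fM]] [[sq0 jac] [x [y xy]] simp].
split; first split=> [u|u v w].
- by apply: (can_inj fK); rewrite fM sq0 linear0.
- by apply: (can_inj fK); rewrite !linearD !fM jac linear0.
- by exists (h x), (h y) => /(congr1 f); rewrite fM !hK linear0.
move=> I [[I0 Ilin] Imul].
have hlin : linear h by move=> a u v; apply: (can_inj fK); rewrite linearP !hK.
have hM u v : h (u ** v) = h u ** h v by apply: (can_inj fK); rewrite fM !hK.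
pose I' : {pred L'} := [pred u | h u \in I].
have I'E u : (u \in I') = (h u \in I) by [].
have /simp[I'0|I'T] : is_ideal I'.
- split=> [|u v]; last by rewrite !I'E !hM; apply: Imul.
  split=> [|a u v]; last by rewrite !I'E hlin; apply: Ilin.
  by rewrite I'E -[0](linear0 f) fK.
- left=> u; rewrite -[u in LHS]fK -I'E I'0 !inE -(linear0 f).
  exact: can_eq fK u 0.
- by right=> u; rewrite -[u]fK -I'E I'T.
Qed.

Section KernelOfProjection.
Variables (F : fieldType) (L g : leibnizType F) (phi : {linear L -> g}).
Hypothesis phiM : {morph phi : x y / x ** y}.

Lemma canonical_lie_isomorphic :
  (forall y, exists x, phi x = y) -> (forall x, (x \in @leib F L) = (phi x == 0)) ->
  leibniz_isomorphic (canonical_lie L) g.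
Proof.
move=> surj ker.
pose psi0 (q : canonical_lie L) := phi (repr (q : Quotient.quot (@leib F L))).
have psi0E x : psi0 (canonical_proj x) = phi x.
  apply/eqP; rewrite -subr_eq0 -linearB -ker; apply/canonical_projP.
  exact: canonical_projK.
have psi0_lin : linear psi0.
  move=> a u v; have [x ->] := canonical_proj_surj u; have [y ->] := canonical_proj_surj v.
  have -> : a *: canonical_proj x = canonical_proj (a *: x) :> canonical_lie L.
    by rewrite canonical_projZ.
  by rewrite -canonical_projD !psi0E linearP.
have [psi psiE] := linear_lift psi0_lin; exists psi; split=> [|u v].
  apply: inj_surj_bijective => [u v|y].
    have [x ->] := canonical_proj_surj u; have [y ->] := canonical_proj_surj v.
    rewrite !psiE !psi0E => E; apply/canonical_projP.
    by rewrite ker linearB E subrr.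
  by have [x <-] := surj y; exists (canonical_proj x); rewrite psiE psi0E.
have [x ->] := canonical_proj_surj u; have [y ->] := canonical_proj_surj v.
have -> : canonical_proj x ** canonical_proj y = canonical_proj (x ** y) :> canonical_lie L.
  by rewrite canonical_projM.
by rewrite !psiE !psi0E phiM.
Qed.

Lemma leib_morph x : x \in @leib F L -> phi x \in @leib F g.
Proof.
move=> /asboolP[n [c [a ->]]]; apply/asboolP; exists n, c, (phi \o a).
by rewrite linear_sum; apply: eq_bigr => i _; rewrite linearZ /= phiM.
Qed.

End KernelOfProjection.

Section LeftModuleOfBimodule.
Variables (F : fieldType) (g : leibnizType F) (M : bimodule g).

Definition left_module_of_bimodule : left_module g :=
  LeftModule (@lact_bilinear F g M) (@bimod_LLM F g M).

Hypothesis M_anti : antisymmetric_bimodule M.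

Lemma antisymmetric_subbimodule (N : {pred M}) :
  subbimodule N <-> @left_submodule F g left_module_of_bimodule N.
Proof.
split=> [[subN actN]|[subN actN]]; split=> // x m Nm; first by have [] := actN x m Nm.
by split; [exact: actN | rewrite M_anti; case: subN].
Qed.

End LeftModuleOfBimodule.

Section CanonicalModule.
Variables (F : fieldType) (L : leibnizType F).

Definition canonical_act (q : canonical_lie L) (x : L) : L :=
  repr (q : Quotient.quot (@leib F L)) ** x.

Lemma canonical_act_proj y x : canonical_act (canonical_proj y) x = y ** x.
Proof.
apply/eqP; rewrite -subr_eq0 -lmulBl leib_lmul0 //.
by apply/canonical_projP; exact: canonical_projK.
Qed.

Fact canonical_act_bilinear : bilinear_for *:%R *:%R canonical_act.
Proof.
split=> u a x y; last by rewrite /canonical_act lmulDr lmulZr.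
have [x' ->] := canonical_proj_surj x; have [y' ->] := canonical_proj_surj y.
have -> : a *: canonical_proj x' = canonical_proj (a *: x') :> canonical_lie L.
  by rewrite canonical_projZ.
by rewrite -canonical_projD !canonical_act_proj lmulDl lmulZl.
Qed.

Fact canonical_act_lmul (x y : canonical_lie L) (m : L) :
  canonical_act (x ** y) m
  = canonical_act x (canonical_act y m) - canonical_act y (canonical_act x m).
Proof.
have [x' ->] := canonical_proj_surj x; have [y' ->] := canonical_proj_surj y.
have -> : canonical_proj x' ** canonical_proj y' = canonical_proj (x' ** y') :> canonical_lie L.
  by rewrite canonical_projM.
by rewrite !canonical_act_proj lmul_leibniz addrK.
Qed.

Definition canonical_module : left_module (canonical_lie L) :=
  LeftModule canonical_act_bilinear canonical_act_lmul.

End CanonicalModule.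

Lemma lie_simple_complement (F : fieldType) (L : leibnizType F) :
    [pchar F] =i pred0 -> finite_dimensional L -> lie_simple L ->
  exists g : subalgebra L,
    simple_lie (subalg g) /\ vs_direct_sum (subalg_pred g) (@leib F L).
Proof.
move=> F0 fd_L simple_L.
have fd_Q : finite_dimensional (canonical_lie L).
  have lin : linear (@canonical_proj F L : L -> canonical_lie L).
    by move=> a x y; rewrite canonical_projD canonical_projZ.
  have [h hE] := linear_lift lin.
  apply: (finite_dimensional_surj (f := h)) fd_L => y.
  by have [x ->] := canonical_proj_surj y; exists x.
have sub_leib : @left_submodule _ _ (canonical_module L) (@leib F L).
  by split; [exact: leib_submod | move=> x m; exact: leib_lmulr].
have [pi [piN piE piM]] := weyl F0 fd_Q simple_L
  (fd_L : finite_dimensional (canonical_module L)) sub_leib.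
have {}piM x y : pi (x ** y) = x ** pi y.
  by rewrite -!canonical_act_proj; exact: piM.
pose P : {pred L} := [pred x | pi x == 0].
have PE x : (x \in P) = (pi x == 0) by [].
have P_submod : submod_closed P.
  split=> [|a x y]; first by rewrite PE linear0.
  by rewrite !PE linearP => /eqP-> /eqP->; rewrite scaler0 addr0.
have P_lmul : {in P &, forall x y, x ** y \in P}.
  by move=> x y _; rewrite !PE piM => /eqP->; rewrite lmul0r.
pose g := Subalgebra P_submod P_lmul; exists g.
have sum_g : vs_direct_sum (subalg_pred g) (@leib F L).
  split=> [x|x /eqP Px Lx]; last by rewrite -(piE _ Lx).
  exists (x - pi x), (pi x); split; [|exact: piN|by rewrite subrK].
  by rewrite PE linearB /= (piE _ (piN x)) subrr.
split=> //; apply: simple_lie_isomorphic simple_L.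
have lin : linear (fun x : subalg g => canonical_proj (val x) : canonical_lie L).
  by move=> a x y; rewrite linearP canonical_projD canonical_projZ.
have [f fE] := linear_lift lin; exists f; split; last first.
  by move=> x y; rewrite !fE val_lmul canonical_projM.
apply: inj_surj_bijective => [x y|q].
  rewrite !fE => /canonical_projP Lxy; apply/val_inj/eqP; rewrite -subr_eq0.
  apply/eqP/(sum_g.2) => //; rewrite -linearB; exact: (valP (x - y)).
have [x ->] := canonical_proj_surj q; have [a [b [ga Lb xE]]] := sum_g.1 x.
exists (Sub a ga); rewrite fE SubK; apply/canonical_projP.
by rewrite xE opprD addrA subrr sub0r rpredN.
Qed.

Lemma completely_reducible_for_ext (F : fieldType) (V : lmodType F)
    (sub sub' : {pred V} -> Prop) :
  (forall N, sub N <-> sub' N) ->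
  completely_reducible_for sub' -> completely_reducible_for sub.
Proof.
move=> sub_sub'; suff -> : sub = sub' by [].
by apply: funext => N; exact: propext.
Qed.

(** * The Leibniz kernel as a module over a complement *)

Section LeibOfComplement.
Variables (F : fieldType) (L : leibnizType F) (g : subalgebra L).
Hypothesis F0 : [pchar F] =i pred0.
Hypothesis fd_L : finite_dimensional L.
Hypothesis simple_g : simple_lie (subalg g).
Hypothesis sum_g : vs_direct_sum (subalg_pred g) (@leib F L).

Lemma finite_dimensional_subalg : finite_dimensional (subalg g).
Proof.
have lin : linear (val : subalg g -> L) by move=> a x y; rewrite linearP.
have [f fE] := linear_lift lin; apply: (finite_dimensional_inj (f := f)) fd_L => x y.
by rewrite !fE => /val_inj.
Qed.

Lemma finite_dimensional_leib : finite_dimensional (leib_bimodule g).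
Proof.
have lin : linear (val : leib_type L -> L) by move=> a x y; rewrite linearP.
have [f fE] := linear_lift lin; apply: (finite_dimensional_inj (f := f)) fd_L => x y.
by rewrite !fE => /val_inj.
Qed.

Lemma leib_antisymmetric : antisymmetric_bimodule (leib_bimodule g).
Proof. by move=> m x; apply: val_inj; exact: (leib_lmul0 _ (valP (m : leib_type L))). Qed.

Lemma leib_completely_reducible : completely_reducible_bi (leib_bimodule g).
Proof.
apply: completely_reducible_for_ext (antisymmetric_subbimodule leib_antisymmetric) _.
exact: (@completely_reducible_left_fd _ _ (left_module_of_bimodule _)
  F0 finite_dimensional_subalg simple_g finite_dimensional_leib).
Qed.

(* For [a = x + m] with [x] in [g] and [m] in [Leib L] one has [a a = x m]: the
   equivariant projector onto a trivial submodule kills all squares. *)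
Lemma leib_no_trivial (N : {pred leib_bimodule g}) :
  subbimodule N -> trivial_on_bi N -> N =i pred1 0.
Proof.
move=> subN trivN.
have subN' := (antisymmetric_subbimodule leib_antisymmetric N).1 subN.
have [pi [piN piE piM]] :=
  @weyl _ _ (left_module_of_bimodule (leib_bimodule g)) N
    F0 finite_dimensional_subalg simple_g finite_dimensional_leib subN'.
have pi_sq a : pi (Sub (a ** a) (leib_sq a)) = 0.
  have [x [m [gx Lm aE]]] := sum_g.1 a.
  have -> : Sub (a ** a) (leib_sq a) = leib_lact (Sub x gx : subalg g) (Sub m Lm).
    apply: val_inj; rewrite /= aE lmulDl !lmulDr !(leib_lmul0 _ Lm) !addr0.
    suff -> : x ** x = 0 by rewrite add0r.
    by apply: sum_g.2; [exact: subalg_lmul | exact: leib_sq].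
  by rewrite [LHS](piM (Sub x gx)); have [] := trivN (Sub x gx) _ (piN (Sub m Lm)).
have pi0 m : pi m = 0.
  have /asboolP[n [c [a mE]]] := valP m.
  have -> : m = \sum_i c i *: (Sub (a i ** a i) (leib_sq (a i)) : leib_type L).
    by apply: val_inj; rewrite linear_sum /= mE; apply: eq_bigr.
  by rewrite linear_sum big1 // => i _; rewrite linearZ /= pi_sq scaler0.
move=> m; rewrite inE; apply/idP/eqP => [Nm|->]; last by case: subN => -[].
by rewrite -(piE _ Nm) pi0.
Qed.

End LeibOfComplement.

Lemma hemisemidirect_of_complement (F : fieldType) (L : leibnizType F) (g : subalgebra L) :
    vs_direct_sum (subalg_pred g) (@leib F L) ->
  leibniz_isomorphic L (hemisemidirect (left_module_of_bimodule (leib_bimodule g))).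
Proof.
move=> [sum_g cap_g]; apply: leibniz_isomorphic_sym.
pose M := left_module_of_bimodule (leib_bimodule g).
(* This direction of the isomorphism is a mere sum, whereas its inverse would require choosing
   components. *)
have lin : linear (fun u : hemisemidirect M => val u.1 + val (u.2 : leib_type L)).
  by move=> a u v; rewrite !linearP scalerDr addrACA.
have [h hE] := linear_lift lin; exists h; split.
  apply: inj_surj_bijective => [u v|x].
    rewrite !hE => E.
    have E' : val u.1 - val v.1 = val (v.2 : leib_type L) - val (u.2 : leib_type L).
      by apply/eqP; rewrite subr_eq addrAC [X in _ == X - _]addrC -E addrK.
    have u1 : val u.1 - val v.1 = 0.
      apply: cap_g; first by rewrite -linearB; exact: (valP (u.1 - v.1)).
      by rewrite E' -linearB; exact: (valP ((v.2 : leib_type L) - u.2)).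
    move: E' u1 => {E}; case: u v => [x m] [y m'] /= E' /eqP u1; congr (_, _).
      by apply/val_inj/eqP; rewrite -subr_eq0.
    by apply/val_inj/eqP; rewrite eq_sym -subr_eq0 -E'.
  have [a [b [ga Lb ->]]] := sum_g x.
  by exists (Sub a ga, Sub b Lb); rewrite hE.
move=> u v; rewrite !hE lmulDl !lmulDr ![val (u.2 : leib_type L) ** _]leib_lmul0 ?addr0 //.
all: exact: valP.
Qed.

(** A square in the hemi-semidirect product is [(0, left_act x m)], so the part [D] of [M] inside
    the Leibniz kernel contains the image of the action. A complement of [D] is then trivial, hence
    zero; so the kernel is all of [M], and the first projection identifies the canonical Lie algebra
    with [g]. *)
Lemma lie_simple_hemisemidirect (F : fieldType) (L g : leibnizType F) (M : left_module g) :
    [pchar F] =i pred0 -> finite_dimensional g -> simple_lie g ->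
    finite_dimensional M ->
    (forall N : {pred M}, left_submodule N -> trivial_on_left N -> N =i pred1 0) ->
    leibniz_isomorphic L (hemisemidirect M) ->
  finite_dimensional L /\ lie_simple L.
Proof.
move=> F0 fd_g simple_g fd_M no_triv [f [[h fK hK] fM]].
have [[sq0 _] _ _] := simple_g.
split.
  apply: (finite_dimensional_inj (f := f)); first exact: can_inj fK.
  exact: (finite_dimensional_pair fd_g fd_M).
pose H := hemisemidirect M.
pose D : {pred M} := [pred m | ((0, m) : H) \in @leib F H].
have DE m : (m \in D) = (((0, m) : H) \in @leib F H) by [].
have D_act x m : left_act x m \in D.
  have -> : (left_act x m \in D) = (((x, m) : H) ** ((x, m) : H) \in @leib F H).
    by rewrite DE /lmul /= /hemi_mul /= sq0.
  exact: leib_sq.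
have subD : left_submodule D.
  split=> [|x m _]; last exact: D_act.
  have [H0 Hlin] := leib_submod H.
  split=> [|a m m']; first exact: H0.
  have E : ((0, a *: m + m') : H) = a *: ((0, m) : H) + ((0, m') : H).
    by apply: (congr2 (@pair g M)); rewrite //= scaler0 addr0.
  by rewrite !DE E; exact: Hlin.
have [pi [piD piE piM]] := weyl F0 fd_g simple_g fd_M subD.
have D_all m : m \in D.
  pose N : {pred M} := [pred m | pi m == 0].
  have NE m' : (m' \in N) = (pi m' == 0) by [].
  (* For [m'] in the kernel of [pi], [left_act x m'] lies in [D], where [pi] is the identity, and
     equivariance sends it to zero. *)
  have N0 : N =i pred1 0.
    apply: no_triv => [|x m' /eqP Nm']; last first.
      by rewrite -(piE _ (D_act x m')) piM Nm' left_act0.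
    split=> [|x m']; last by rewrite !NE piM => /eqP->; rewrite left_act0.
    split=> [|a u v]; first by rewrite NE linear0.
    by rewrite !NE linearP => /eqP-> /eqP->; rewrite scaler0 addr0.
  have : m - pi m \in N by rewrite NE linearB /= (piE _ (piD m)) subrr.
  by rewrite N0 inE subr_eq0 => /eqP->.
have hlin : linear h by move=> a x y; apply: (can_inj fK); rewrite linearP !hK.
have [h' h'E] := linear_lift hlin.
have h'M : {morph h' : x y / x ** y}.
  by move=> x y; apply: (can_inj fK); rewrite !h'E fM !hK.
have philin : linear (fun x => (f x).1) by move=> a x y; rewrite linearP.
have [phi phiE] := linear_lift philin.
have phiM : {morph phi : x y / x ** y} by move=> x y; rewrite !phiE fM.
apply: simple_lie_isomorphic simple_g; apply: (canonical_lie_isomorphic phiM).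
  by move=> y; exists (h (y, 0)); rewrite phiE hK.
move=> x; apply/idP/eqP => [/(leib_morph phiM)/asboolP[n [c [a ->]]]|].
  by rewrite big1 // => i _; rewrite sq0 scaler0.
rewrite phiE => fx0; have : ((0, (f x).2) : H) \in @leib F H by rewrite -DE D_all.
have -> : ((0, (f x).2) : H) = f x by rewrite -fx0; case: (f x).
by move/(leib_morph h'M); rewrite h'E fK.
Qed.

Theorem theorem3p2 (F : fieldType) (charF0 : [pchar F] =i pred0)
    (L : leibnizType F) :
  let stmt_i := finite_dimensional L /\ lie_simple L in
  let stmt_ii :=
    exists g : subalgebra L,
      [/\ finite_dimensional (subalg g),
          simple_lie (subalg g) &
          vs_direct_sum (subalg_pred g) (@leib F L)] /\
      [/\ finite_dimensional (leib_bimodule g),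
          completely_reducible_bi (leib_bimodule g),
          antisymmetric_bimodule (leib_bimodule g) &
          forall N : {pred leib_bimodule g},
            subbimodule N -> trivial_on_bi N -> N =i pred1 0] in
  let stmt_iii :=
    exists (g : leibnizType F) (M : left_module g),
      [/\ finite_dimensional g & simple_lie g] /\
      [/\ finite_dimensional M,
          completely_reducible_left M,
          forall N : {pred M},
            left_submodule N -> trivial_on_left N -> N =i pred1 0 &
          leibniz_isomorphic L (hemisemidirect M)] in
  (stmt_i <-> stmt_ii) /\ (stmt_ii <-> stmt_iii).
Proof.
move=> stmt_i stmt_ii stmt_iii.
have i_ii : stmt_i -> stmt_ii.
  move=> [fd_L simple_L].
  have [g [simple_g sum_g]] := lie_simple_complement charF0 fd_L simple_L.
  exists g; split; split=> //.
  - exact: finite_dimensional_subalg.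
  - exact: finite_dimensional_leib.
  - exact: leib_completely_reducible.
  - exact: leib_antisymmetric.
  - exact: leib_no_trivial.
have ii_iii : stmt_ii -> stmt_iii.
  move=> [g [[fd_g simple_g sum_g] [fd_M cr_M anti_M no_triv]]].
  exists (subalg g), (left_module_of_bimodule (leib_bimodule g)); split; split=> //.
  - apply: completely_reducible_for_ext cr_M => N.
    by split => /(antisymmetric_subbimodule anti_M).
  - move=> N /(antisymmetric_subbimodule anti_M) subN trivN.
    by apply: no_triv => // x m Nm; split; [exact: trivN | exact: anti_M].
  - exact: hemisemidirect_of_complement.
have iii_i : stmt_iii -> stmt_i.
  move=> [g [M [[fd_g simple_g] [fd_M _ no_triv isoL]]]].
  exact: lie_simple_hemisemidirect no_triv isoL.
split; split=> //; by [move=> /ii_iii/iii_i | move=> /iii_i/i_ii].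
Qed.
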